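(* For every $\gamma\in(0,1)$ there exists $\epsilon=\epsilon(\gamma)>0$ such that the following holds. Let $p$ be a sufficiently large prime, let $E\subseteq\mathbb{F}_p^2\setminus\{(0,0)\}$, and let $S$ be a symmetric subset of $SL_2(\mathbb{F}_p)$ with $p^\gamma<|S|<p^{3-2\gamma}$ and $|S\cap gH|<p^{-\gamma/2}|S|$ for every proper subgroup $H\subsetneq SL_2(\mathbb{F}_p)$ and every $g\in SL_2(\mathbb{F}_p)$. Then \[|S(E)|\gg\min\left\{p^2,~\frac{|S|^{1/2}|E|}{p^{1-\frac{\epsilon}{2}}}\right\}.\] Moreover, if every line through the origin contains at most $k$ points of $E$, then \[|S(E)|\gg\min\left\{p^2,~\frac{|S|^{1/2}|E|}{p^{\frac{1-\epsilon}{2}}k^{1/2}}\right\}.\]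
   Context: $S$ symmetric means $S=S^{-1}$. Matrices act on column vectors and $S(E)=\{\theta e:e\in E,\theta\in S\}$. A line through the origin is a one-dimensional subspace of $\mathbb{F}_p^2$. $X\gg Y$ means $X\ge cY$ for a constant $c>0$ independent of $p,E,S,k$. *)

(* Defs.v *)
From HB Require Import structures.
From mathcomp Require Import all_boot all_order all_fingroup all_algebra.
From mathcomp Require Import reals exp.

Set Implicit Arguments.
Unset Strict Implicit.
Unset Printing Implicit Defensive.

Import GroupScope GRing.Theory Num.Theory.
Local Open Scope ring_scope.

(* Only meant for [prime p]: otherwise ['F_p] is the field whose order is the
   least prime divisor of [p] (or 2). *)
Definition SL2 (p : nat) : {set {'GL_2['F_p]}} :=
  [set u | \det (GLval u) == 1].

Lemma SL2_group_set (p : nat) : group_set (SL2 p).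
Proof.
apply/group_setP; split=> [|u v]; first by rewrite inE det1.
by rewrite !inE det_mulmx => /eqP-> /eqP->; rewrite mulr1.
Qed.

Canonical SL2_group (p : nat) : {group {'GL_2['F_p]}} :=
  Group (SL2_group_set p).

Definition SL2_image (p : nat) (S : {set {'GL_2['F_p]}})
    (E : {set 'cV['F_p]_2}) : {set 'cV['F_p]_2} :=
  [set GLval u *m e | u in S, e in E].

Definition non_concentrated (R : realType) (gamma : R) (p : nat)
    (S : {set {'GL_2['F_p]}}) : Prop :=
  forall (H : {group {'GL_2['F_p]}}) (g : {'GL_2['F_p]}),
    H \proper SL2 p -> g \in SL2 p ->
    #|S :&: (g *: H)%g|%:R < p%:R `^ (- (gamma / 2)) * #|S|%:R.

Definition at_most_on_lines (p : nat) (k : nat) (E : {set 'cV['F_p]_2}) : Prop :=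
  forall L : {vspace 'cV['F_p]_2},
    \dim L = 1%N -> (#|[set e in E | e \in L]| <= k)%N.

(* Main.v *)
Require Import Defs.
From mathcomp Require Import all_boot all_order all_fingroup all_algebra.
From mathcomp Require Import reals exp.
From mathcomp Require Import zify ring lra.

(** Write r(g) for the number of (a, b) in S x S with a b^-1 = g, and c(g) for the
    number of e in E with g e in E. Counting the solutions of a x, b x in E and applying
    Cauchy-Schwarz on the support S(E) reduces the theorem to the sum of r(g) c(g), hence to
    the variance of c over SL_2 and to the energy of S, the sum of r(g)^2.

    Variance. For independent e, e', an element of SL_2 is determined by the images of e and
    e', and the determinant is preserved, so the second moment of c is governed by the number
    of quadruples of E with det(e, e') = det(f, f'). A duality (large sieve) argument gives
    |E|^4 / p + O(p k |E|^2) such quadruples, because x |-> (det(x, e), det(x, e')) is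
    bijective unless e and e' are proportional. The first bound is the second one with k = p.

    Energy. It is at most 2 |S|^3 p^-eps. Otherwise Balog-Szemeredi-Gowers yields a subset of S
    with small doubling, and its popular quotients form a symmetric set D all of whose powers
    are about as large as D, and which is spread out over the cosets of proper subgroups. The
    following argument of Larsen-Pink type shows that D cannot exist. If t is a trace other
    than 0, 2, -2, the map (w, x, y) |-> (w^-1 x, w^-1 y) has fibres of size at most 2 on the
    triples of trace t that neither lie in a common Borel subgroup nor are degenerate, so a
    conjugacy class of trace t meets powers of D in O(|D|^(2/3)) elements. Hence a maximal
    torus that contains one regular element of D^2 contains at least about |D|^(1/3) of them.
    Conjugation by D then propagates this to all conjugates of the torus, and adding up
    their contributions gives |D| of order p^3. *)

Set Implicit Arguments.
Unset Strict Implicit.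
Unset Printing Implicit Defensive.
Import Order.TTheory GroupScope GRing.Theory Num.Theory.
Local Open Scope ring_scope.

(** * Counting *)

Section Counting.
Local Open Scope nat_scope.

Lemma sum_card_fibers (T U : finType) (f : T -> U) (X : {set T}) (Y : {pred U}) :
  {in X, forall x, f x \in Y} -> \sum_(y in Y) #|[set x in X | f x == y]| = #|X|.
Proof.
move=> XY; rewrite -sum1_card (partition_big f (mem Y)) //=.
by apply: eq_bigr => y _; rewrite -sum1_card; apply: eq_bigl => x; rewrite !inE.
Qed.

Lemma card_fibers_ge (T U : finType) (f : T -> U) (X : {set T}) (Y : {set U})
    (k m : nat) :
  (forall y, y \in Y -> m <= k * #|[set x in X | f x == y]|) ->
  #|Y| * m <= k * #|X|.
Proof.
move=> h; rewrite -(sum_card_fibers (f := f) (Y := predT)) // -sum_nat_const.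
rewrite big_distrr /= [X in _ <= X](bigID (mem Y)) /=.
by apply: leq_trans (leq_addr _ _); apply: leq_sum.
Qed.

Lemma card_fibers_le (T U : finType) (f : T -> U) (X : {set T}) (Y : {set U})
    (m : nat) :
  {in X, forall x, f x \in Y} ->
  (forall y, y \in Y -> #|[set x in X | f x == y]| <= m) ->
  #|X| <= #|Y| * m.
Proof.
move=> XY h; rewrite -(sum_card_fibers XY) -sum_nat_const.
exact: leq_sum.
Qed.

Lemma sum_sqr_fibers (T U : finType) (f : T -> U) (X : {set T}) :
  \sum_y #|[set x in X | f x == y]| ^ 2 =
  #|[set z in setX X X | f z.1 == f z.2]|.
Proof.
rewrite -(sum_card_fibers (f := fun z => f z.1) (Y := predT)) //.
apply: eq_bigr => y _; rewrite -mulnn -cardsX; congr #|pred_of_set _|.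
apply/setP => -[a b]; rewrite !inE /=.
by case: (a \in X); case: (b \in X); case: eqP => //= [->|]; rewrite 1?eq_sym ?andbF // andbT.
Qed.

(** Cauchy-Schwarz against the constant 1, kept in the natural numbers by summing 2ab <= a^2 + b^2
    over all pairs of indices. *)
Lemma sqr_sum_le (I : finType) (P : {pred I}) (F : I -> nat) :
  (\sum_(i in P) F i) ^ 2 <= #|P| * \sum_(i in P) F i ^ 2.
Proof.
rewrite -(leq_pmul2l (m := 2)) // -mulnn.
have -> : 2 * (#|P| * \sum_(i in P) F i ^ 2) =
  \sum_(i in P) \sum_(j in P) (F i ^ 2 + F j ^ 2).
  rewrite [RHS](eq_bigr (fun i => #|P| * F i ^ 2 + \sum_(j in P) F j ^ 2)) => [|i _].
    by rewrite big_split /= sum_nat_const -big_distrr /= addnn mul2n.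
  by rewrite big_split /= sum_nat_const.
rewrite big_distrlr /= big_distrr /=; apply: leq_sum => i _.
rewrite big_distrr /=; apply: leq_sum => j _; exact: nat_Cauchy.
Qed.

(** Values with 2 K r(g) < n contribute at most n^3 / (2K) to the second moment, half of what is
    assumed. The popular values supply the other half, and there r(g)^2 <= n r(g). *)
Lemma popular_sum (T : finType) (r : T -> nat) (n K : nat) :
  \sum_g r g = n ^ 2 -> (forall g, r g <= n) -> 0 < n ->
  n ^ 3 <= K * \sum_g r g ^ 2 ->
  n ^ 2 <= 2 * K * \sum_(g | n <= 2 * K * r g) r g.
Proof.
move=> sr rn n0 h; set P := fun g => n <= 2 * K * r g.
have e1 : 2 * K * \sum_(g | ~~ P g) r g ^ 2 <= n ^ 3.
  rewrite [n ^ 3]expnS -sr !big_distrr /= [X in _ <= X](bigID P) /=.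
  apply: leq_trans (leq_addl _ _); apply: leq_sum => g; rewrite /P -ltnNge => lt.
  by rewrite -mulnn mulnA leq_mul2r (ltnW lt) orbT.
have e2 : \sum_(g | P g) r g ^ 2 <= n * \sum_(g | P g) r g.
  rewrite big_distrr; apply: leq_sum => g _; by rewrite -mulnn leq_mul2r rn orbT.
rewrite (bigID P) /= in h.
set a := \sum_(g | P g) _ in h e2; set b := \sum_(g | ~~ P g) _ in h e1.
rewrite -/P; set s := \sum_(g | P g) _ in e2 *.
rewrite -(leq_pmul2l n0) -expnS.
have : 2 * K * a <= 2 * K * (n * s) by rewrite leq_mul2l e2 orbT.
nia.
Qed.

End Counting.

(** * Representation counts and multiplicative energy *)

Section Growth.
Variable gT : finGroupType.
Implicit Types (S A D P : {set gT}) (g : gT).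
Local Open Scope group_scope.
Local Open Scope nat_scope.

Definition rep S g : nat := #|[set x in setX S S | (x.1 * x.2^-1)%g == g]|.
Definition energy S : nat := \sum_g rep S g ^ 2.

Lemma sum_rep S : \sum_g rep S g = #|S| ^ 2.
Proof. by rewrite (sum_card_fibers (Y := predT)) // cardsX mulnn. Qed.

Lemma rep_le S g : rep S g <= #|S|.
Proof.
rewrite /rep -(@card_in_imset _ _ (fun z => z.1)) => [|[a b] [c d]]; last first.
  rewrite !inE /= => /andP[_ /eqP <-] /andP[_ /eqP + ac]; rewrite -{}ac.
  by move/mulgI/invg_inj->.
apply: subset_leq_card; apply/subsetP => _ /imsetP[x + ->].
by rewrite !inE => /andP[/andP[]].
Qed.

Lemma repV S g : rep S g^-1 = rep S g.
Proof.
have swK : involutive (fun z : gT * gT => (z.2, z.1)) by case.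
rewrite /rep -[RHS](card_imset _ (inv_inj swK)).
congr #|pred_of_set _|; apply/setP=> -[a b]; apply/idP/imsetP; last first.
  case=> -[c d]; rewrite !inE /= => + [-> ->] => /andP[/andP[-> ->] /eqP h] /=.
  by rewrite -h invMg invgK.
rewrite !inE /= => /andP[/andP[aS bS] /eqP h].
by exists (b, a); rewrite // !inE /= aS bS -[g]invgK -h invMg invgK /=.
Qed.

Lemma rep1 S : rep S 1 = #|S|.
Proof.
rewrite -(card_imset S (f := fun x => (x, x))) => [|? ? []] //.
congr #|pred_of_set _|; apply/setP=> -[a b]; apply/idP/imsetP.
  by rewrite !inE /= -eq_mulgV1 => /andP[/andP[_ bS] /eqP ->]; exists b.
by case=> x xS [-> ->]; rewrite !inE /= xS mulgV eqxx.
Qed.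

(** Since a b^-1 = c d^-1 amounts to a^-1 c = b^-1 d, inverting the entries and exchanging the two
    middle ones matches the quadruples of S^-1 with those of S. *)
Lemma energyV S : energy S^-1 = energy S.
Proof.
rewrite /energy !sum_sqr_fibers.
pose h (z : (gT * gT) * (gT * gT)) :=
  ((z.1.1^-1, z.2.1^-1), (z.1.2^-1, z.2.2^-1))%g.
have hK : involutive h by case=> [[a b] [c d]]; rewrite /h /= !invgK.
rewrite -[LHS](card_imset _ (inv_inj hK)); congr #|pred_of_set _|.
have key (a b c d : gT) : (a * b^-1 == c * d^-1)%g = (a^-1 * c == b^-1 * d)%g.
  apply/eqP/eqP => e; first by rewrite -[c](mulgKV d) -e !mulgA mulVg mul1g.
  by rewrite -[c](mulKVg a) e !mulgA mulgK.
apply/setP=> -[[a b] [c d]]; apply/imsetP/idP.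
  case=> -[[a' b'] [c' d']]; rewrite !inE /= => + [-> -> -> ->] => /andP[h1 h2].
  rewrite /= ?invgK in h1 h2 *; rewrite -key h2 andbT.
  by case/andP: h1 => /andP[-> ->] /andP[-> ->].
rewrite !inE /= => /andP[h1 h2]; exists (h ((a, b), (c, d))); last by rewrite hK.
rewrite !inE /= !invgK -key h2 andbT.
by case/andP: h1 => /andP[-> ->] /andP[-> ->].
Qed.

End Growth.

(** * The Balog-Szemeredi-Gowers theorem *)

Section BSG.
Local Open Scope nat_scope.

Lemma card_sep_sum (T : finType) (A : {set T}) (c : pred T) :
  #|[set x in A | c x]| = \sum_(x in A) c x.
Proof.
rewrite -sum1_card (eq_bigl (fun x => (x \in A) && c x)) => [|x]; last by rewrite inE.
by rewrite big_mkcondr; apply: eq_bigr => x _; case: (c x).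
Qed.

Variable gT : finGroupType.
Implicit Types (S A D P : {set gT}) (g : gT).
Local Open Scope group_scope.
Local Open Scope nat_scope.

Section Graph.
Variables (S : {set gT}) (K : nat).
Hypothesis S0 : 0 < #|S|.
Hypothesis hE : #|S| ^ 3 <= K * energy S.
Let n := #|S|.
(** Popular quotients are the edges of a graph on S, where a and x are joined when a x^-1 lies in
    [P]; [N x] is a neighbourhood, and [B] collects the pairs with too few common neighbours. *)
Let P := [set g | n <= 2 * K * rep S g].
Let N x := [set a in S | (a * x^-1)%g \in P].
Let common (z : gT * gT) := [set x in S | (z.1 \in N x) && (z.2 \in N x)].
Let B := [set z in setX S S | 64 * K ^ 2 * #|common z| < n].

Let PV g : (g^-1 \in P) = (g \in P).
Proof. by rewrite !inE repV. Qed.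

Let cardP : #|P| <= 2 * K * n.
Proof.
rewrite -(leq_pmul2r S0) -/n -mulnA mulnn -(sum_rep S) -sum_nat_const big_distrr /=.
rewrite [X in _ <= X](bigID (mem P)) /=; apply: leq_trans (leq_addr _ _).
by apply: leq_sum => g; rewrite inE.
Qed.

(** By [popular_sum] the popular quotients account for at least n^2 / (2K) pairs of S, and each such
    pair is an edge. *)
Let sumN : n ^ 2 <= 2 * K * \sum_(x in S) #|N x|.
Proof.
apply: leq_trans (popular_sum (sum_rep S) (rep_le S) S0 hE) _.
rewrite leq_mul2l; apply/orP; right.
pose X := [set z in setX S S | (z.1 * z.2^-1)%g \in P].
have XP : {in X, forall z, (z.1 * z.2^-1)%g \in P} by move=> z; rewrite inE => /andP[].
have XS : {in X, forall z, z.2 \in S} by move=> z; rewrite !inE => /andP[/andP[]].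
have nP g : (n <= 2 * K * rep S g) = (g \in P) by rewrite inE.
rewrite (eq_bigl _ _ nP).
have -> : \sum_(g in P) rep S g = #|X|.
  rewrite -(sum_card_fibers XP); apply: eq_bigr => g gP.
  congr #|pred_of_set _|; apply/setP=> z; rewrite !inE -!andbA; congr andb; congr andb.
  by apply/eqP/andP => [->|[_ /eqP]] //; split=> //; move: gP; rewrite inE.
rewrite -(sum_card_fibers XS); apply: leq_sum => x xS.
rewrite -(@card_in_imset _ _ (fun z => z.1)) => [|[a b] [c d]]; last first.
  by rewrite !inE /= => /andP[_ /eqP->] /andP[_ /eqP->] ->.
apply: subset_leq_card; apply/subsetP => _ /imsetP[[a b] + ->].
by rewrite !inE /= => /andP[/andP[/andP[-> _]] + /eqP <-].
Qed.

(** Exchanging the sums counts each bad pair once per common neighbour, hence fewer than n / (64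
    K^2) times, and there are at most n^2 pairs. *)
Let sum_bad : 64 * K ^ 2 * \sum_(x in S) #|[set z in setX (N x) (N x) | z \in B]| <= n ^ 3.
Proof.
have -> : \sum_(x in S) #|[set z in setX (N x) (N x) | z \in B]| =
          \sum_(z in B) #|common z|.
  rewrite [RHS](eq_bigr _ (fun z _ => card_sep_sum S _)) exchange_big /=.
  apply: eq_bigr => x xS; rewrite -card_sep_sum.
  by congr #|pred_of_set _|; apply/setP=> -[a b]; rewrite inE /= in_setX andbC [RHS]inE.
rewrite big_distrr /= [n ^ 3]expnSr.
apply: (@leq_trans (\sum_(z in B) n)).
  by apply: leq_sum => z; rewrite inE => /andP[_ /ltnW].
rewrite sum_nat_const leq_mul2r; apply/orP; right.
rewrite -mulnn -cardsX; apply: subset_leq_card; apply/subsetP => z.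
by rewrite inE => /andP[].
Qed.

(* Dependent random choice: in the neighbourhood of an average vertex, at most one pair in
   eight has few common neighbours. *)
Let dense_nbhd : exists2 x, x \in S &
  n ^ 2 + 64 * K ^ 2 * #|[set z in setX (N x) (N x) | z \in B]|
     <= 8 * K ^ 2 * #|N x| ^ 2.
Proof.
apply/exists_inP; apply: contraT => /exists_inPn h.
have e1 : \sum_(x in S) (8 * K ^ 2 * #|N x| ^ 2 + 1) <=
  \sum_(x in S) (n ^ 2 + 64 * K ^ 2 * #|[set z in setX (N x) (N x) | z \in B]|).
  by apply: leq_sum => x xS; rewrite addn1 ltnNge h.
rewrite !big_split /= -!big_distrr /= !sum_nat_const muln1 -/n mulnn -expnS in e1.
have e2 := sqr_sum_le (mem S) (fun x => #|N x|).
have e3 : n ^ 4 <= 4 * K ^ 2 * (n * \sum_(x in S) #|N x| ^ 2).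
  apply: (@leq_trans ((2 * K * \sum_(x in S) #|N x|) ^ 2)).
    by rewrite -[4]/(2 * 2)%N expnM leq_exp2r.
  by rewrite !expnMn leq_mul2l e2 orbT.
have e4 : n ^ 3 <= 4 * K ^ 2 * \sum_(x in S) #|N x| ^ 2.
  by rewrite -(leq_pmul2l S0) -expnS; apply: leq_trans e3 _; rewrite mulnCA.
move: sum_bad e1 e4 S0; rewrite -/n.
set b := \sum_(x in S) #|[set _ in _ | _]|; set s := \sum_(x in S) _ ^ 2.
set m := n ^ 3; nia.
Qed.

(** Inside a good neighbourhood, keep the vertices that are bad with few others. A quotient of two
    of these factors into four popular quotients in many ways, and |P| <= 2 K n bounds the number of
    all factorisations. *)
Lemma bsg : exists A : {set gT}, [/\ A \subset S, n <= 6 * K * #|A| &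
  #|(A * A^-1)%g| * n ^ 3 <= 3 * K * (2 * (64 * K ^ 2) ^ 2 * (2 * K * n) ^ 4)].
Proof.
have [x xS hx] := dense_nbhd; set A := N x in hx.
set bad := #|_| in hx.
have A1 : n <= 3 * K * #|A|.
  by rewrite -(@leq_exp2r _ _ 2) // !expnMn; nia.
have A0 : 0 < #|A| by move: S0 A1; rewrite -/n; nia.
have K0 : 0 < K by move: S0 A1; rewrite -/n; nia.
have bad8 : 8 * bad <= #|A| ^ 2.
  by rewrite -(leq_pmul2l (m := 8 * K ^ 2)) ?muln_gt0 ?expn_gt0 ?K0 //; nia.
(* At most an eighth of the pairs of A are bad, so at most half of the vertices are bad with more
   than a quarter of A. *)
pose A' := [set a in A | 4 * #|[set c in A | (a, c) \in B]| <= #|A|].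
have A'A : A' \subset A by apply/subsetP => a; rewrite inE => /andP[].
have AA' : #|A| <= 2 * #|A'|.
  have h : #|A :\: A'| * #|A| <= 4 * bad.
    apply: (card_fibers_ge (f := fun z => z.1)) => a /setDP[aA].
    rewrite inE aA /= -ltnNge => /ltnW h; apply: leq_trans h _.
    rewrite leq_mul2l /= -(card_imset _ (f := fun c => (a, c))) => [|? ? []] //.
    apply: subset_leq_card; apply/subsetP => _ /imsetP[c /setIdP[cA cB] ->].
    apply/setIdP; rewrite eqxx; split=> //; apply/setIdP; split=> //.
    by rewrite in_setX aA cA.
  have := cardsID A' A; rewrite (setIidPr A'A) => e.
  have : 2 * #|A :\: A'| <= #|A| by rewrite -(leq_pmul2r A0); nia.
  lia.
exists A'; split.
- by apply: subset_trans A'A _; apply/subsetP => a; rewrite inE => /andP[].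
- by apply: leq_trans A1 _; nia.
suff h : #|(A' * A'^-1)%g| * (#|A| * n ^ 2) <=
    2 * (64 * K ^ 2) ^ 2 * #|setX (setX P P) (setX P P)|.
  rewrite !cardsX in h.
  have h2 : 2 * (64 * K ^ 2) ^ 2 * (#|P| * #|P| * (#|P| * #|P|)) <=
            2 * (64 * K ^ 2) ^ 2 * (2 * K * n) ^ 4.
    rewrite leq_mul2l; apply/orP; right.
    by rewrite -[4]/(2 * 2)%N expnM -!mulnn !leq_mul.
  have h3 := leq_trans h h2.
  apply: leq_trans (_ : _ <= 3 * K * (#|(A' * A'^-1)%g| * (#|A| * n ^ 2))) _.
    rewrite expnS; set u := n ^ 2; set v := #|(A' * A'^-1)%g|.
    by have := leq_mul (leqnn (u * v)) A1; nia.
  by rewrite leq_mul2l h3 orbT.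
(* Every a * a'^-1 is a product of four popular quotients along many paths
   a - x1 - c - x2 - a'. *)
pose pr (z : (gT * gT) * (gT * gT)) := (z.1.1 * z.1.2 * z.2.1 * z.2.2)%g.
apply: (card_fibers_ge (f := pr)) => q /mulsgP[a a1 aA' ]; rewrite mem_invg.
set a' := a1^-1%g => a'A' ->.
(* Each of a and a' rules out at most a quarter of A, so at least half of A remains for c; every
   such c allows at least n / (64 K^2) choices of x1 and as many of x2. *)
pose C := [set c in A | ((a, c) \notin B) && ((a', c) \notin B)].
have cardC : #|A| <= 2 * #|C|.
  have : A \subset C :|: [set c in A | (a, c) \in B] :|: [set c in A | (a', c) \in B].
    apply/subsetP => c cA; case: (boolP ((a, c) \in B)) => aB.
      by apply/setUP; left; apply/setUP; right; apply/setIdP.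
    case: (boolP ((a', c) \in B)) => a'B; first by apply/setUP; right; apply/setIdP.
    by apply/setUP; left; apply/setUP; left; apply/setIdP; rewrite aB.
  move=> /subset_leq_card h.
  have [h1 _] := leq_card_setU (C :|: [set c in A | (a, c) \in B]) [set c in A | (a', c) \in B].
  have [h2 _] := leq_card_setU C [set c in A | (a, c) \in B].
  case/setIdP: aA' => _ h3; case/setIdP: a'A' => _ h4.
  have := leq_trans h (leq_trans h1 (leq_add h2 (leqnn _))).
  by move: h3 h4; set u := #|[set c in A | (a, c) \in B]|; set v := #|[set _ in _ | _]|; lia.
pose T := [set z : gT * (gT * gT) | [&& z.1 \in C, z.2.1 \in common (a, z.1)
     & z.2.2 \in common (a', z.1)]].
have cardT : #|C| * n ^ 2 <= (64 * K ^ 2) ^ 2 * #|T|.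
  apply: (card_fibers_ge (f := fun z => z.1)) => c cC.
  rewrite (_ : #|_| = #|common (a, c)| * #|common (a', c)|); last first.
    rewrite -cardsX -(card_imset (setX _ _) (f := fun y => (c, y))) => [|? ? []] //.
    congr #|pred_of_set _|; apply/setP => -[c1 [x1 x2]]; apply/idP/imsetP.
      rewrite inE /= inE /= => /andP[/and3P[_ h1 h2] /eqP e]; subst c1.
      by exists (x1, x2); rewrite ?in_setX ?h1 ?h2.
    case=> -[y1 y2]; rewrite in_setX => /andP[h1 h2] [-> -> ->].
    by rewrite inE /= inE /= eqxx cC h1 h2.
  have inS u : u \in A -> u \in S by case/setIdP.
  have NB u v : u \in A -> v \in A -> (u, v) \notin B ->
      n <= 64 * K ^ 2 * #|common (u, v)|.
    move=> uA vA; rewrite leqNgt; apply: contra => h.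
    by apply/setIdP; rewrite in_setX !inS.
  case/setIdP: cC => cA /andP[/(NB _ _ (subsetP A'A _ aA') cA) h1].
  move=> /(NB _ _ (subsetP A'A _ a'A') cA) h2.
  by rewrite -!mulnn [X in _ <= X]mulnACA leq_mul.
apply: (@leq_trans (2 * (#|C| * n ^ 2))).
  by rewrite mulnA leq_mul2r cardC orbT.
rewrite -mulnA leq_mul2l /=; apply: leq_trans cardT _.
rewrite leq_mul2l; apply/orP; right.
pose h (z : gT * (gT * gT)) :=
  ((a * z.2.1^-1, z.2.1 * z.1^-1), (z.1 * z.2.2^-1, z.2.2 * a'^-1))%g.
rewrite -(card_imset _ (f := h)); last first.
  move=> [c [x1 x2]] [c' [x1' x2']] [] /mulgI/invg_inj -> /mulgI/invg_inj -> _.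
  by move/mulIg->.
apply: subset_leq_card; apply/subsetP => _ /imsetP[[c [x1 x2]] + ->].
rewrite inE /= => /and3P[_ /setIdP[_ /andP[/setIdP[_ h1] /setIdP[_ h2]]]].
case/setIdP=> _ /andP[/setIdP[_ h4] /setIdP[_ h3]].
apply/setIdP; split; last by rewrite /pr /= !mulgA !mulgKV invgK.
rewrite /= in h1 h2 h3 h4.
by rewrite !in_setX /= h1 h3 -(PV (x1 * _)) -(PV (x2 * _)) !invMg !invgK h2 h4.
Qed.

End Graph.
End BSG.

(** * Popular quotients of a set with small doubling *)

Section PopularQuotients.
Variable gT : finGroupType.
Implicit Types (S A D P : {set gT}) (g : gT).
Local Open Scope group_scope.
Local Open Scope nat_scope.

(** As K >= 2, numerical factors are absorbed into powers of K, for instance 6 K <= K^4 and 64 <=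
    K^6. The quotient set has at most K^28 |S| elements, and |S| <= K^4 |A| turns 28 into 32. *)
Lemma bsg_pow S K : 1 < K -> 0 < #|S| -> #|S| ^ 3 <= K * energy S ->
  exists A : {set gT}, [/\ A \subset S, #|S| <= K ^ 4 * #|A| &
    #|(A * A^-1)%g| <= K ^ 32 * #|A|].
Proof.
move=> K1 S0 hE; have [A [AS A1 A2]] := bsg S0 hE; exists A.
have K0 : 0 < K by apply: ltnW.
have e2 : 2 <= K by [].
have e4 : 4 <= K ^ 2 by rewrite -[4]/(2 ^ 2)%N leq_exp2r.
have e64 : 64 <= K ^ 6 by rewrite (_ : 64 = 2 ^ 6)%N // leq_exp2r.
have e6 : 6 * K <= K ^ 4.
  rewrite [K ^ 4]expnSr leq_mul2r; apply/orP; right.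
  by apply: (@leq_trans (2 ^ 3)); rewrite // leq_exp2r.
split=> //; first by apply: leq_trans A1 _; rewrite leq_mul2r e6 orbT.
set q := #|(A * A^-1)%g| in A2 *; set n := #|S| in S0 A1 A2.
have h : 3 * K * (2 * (64 * K ^ 2) ^ 2 * (2 * K * n) ^ 4) <=
         (K ^ 2 * K * (K * (K ^ 6 * K ^ 2) ^ 2 * (K * K) ^ 4) * n) * n ^ 3.
  have h1 : 3 * K * (2 * (64 * K ^ 2) ^ 2) <= K ^ 2 * K * (K * (K ^ 6 * K ^ 2) ^ 2).
    apply: leq_mul; last by apply: leq_mul; rewrite ?leq_exp2r // leq_mul2r e64 orbT.
    by rewrite leq_mul2r (ltnW e4) orbT.
  have h2 : (2 * K) ^ 4 <= (K * K) ^ 4 by rewrite leq_exp2r // leq_mul2r e2 orbT.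
  rewrite (expnMn (2 * K) n) -[X in _ <= X]mulnA -expnS [X in X <= _]mulnA.
  rewrite [X in X <= _]mulnA; apply: leq_mul (leqnn _).
  by apply: leq_trans (leq_mul h1 h2) _; rewrite -(mulnA (K ^ 2 * K)).
have {h} : q <= K ^ 28 * n.
  rewrite -(@leq_pmul2r (n ^ 3)) ?expn_gt0 ?S0 //; apply: leq_trans A2 _.
  apply: leq_trans h _; rewrite leq_mul2r; apply/orP; right.
  by rewrite leq_mul2r mulnn -expnSr -expnD -!expnM -expnS -!expnD leqnn orbT.
move=> h; apply: leq_trans h _; rewrite -[32]/(28 + 4)%N expnD -mulnA leq_mul2l.
by apply/orP; right; apply: leq_trans A1 _; rewrite leq_mul2r e6 orbT.
Qed.

Section Quotients.
Variables (A : {set gT}) (L : nat).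
Hypothesis A0 : 0 < #|A|.
Hypothesis hL : #|(A * A^-1)%g| <= L * #|A|.
(** Taking [rep] of the inverse set makes these the quotients x^-1 y with x, y in A, a form that can
    be split in the middle of a product. *)
Let D := [set g | #|A| <= 2 * L * rep A^-1 g].

Let L0 : 0 < L.
Proof.
have : A \proper set0 -> false by rewrite properE sub0set andbF.
have [x xA] := card_gt0P A0.
have : 0 < #|(A * A^-1)%g| by apply/card_gt0P; exists (x * x^-1)%g; rewrite mem_mulg ?mem_invg ?invgK.
by move=> h; have := leq_trans h hL; rewrite muln_gt0 => /andP[].
Qed.

(** Cauchy-Schwarz on the support of [rep A], which lies in A A^-1 and so has at most L |A|
    elements. *)
Let energy_lb : #|A| ^ 3 <= L * energy A.
Proof.
have h : \sum_(g in (A * A^-1)%g) rep A g = #|A| ^ 2.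
  rewrite -(sum_rep A) [RHS](bigID (mem (A * A^-1)%g)) /= [X in _ = _ + X]big1 ?addn0 //.
  move=> g gA; apply/eqP; rewrite cards_eq0 -subset0; apply/subsetP => -[u v].
  case/setIdP=> /setXP[/= a b] /eqP e; case/negP: gA.
  by rewrite -e mem_mulg // mem_invg invgK.
have h2 := sqr_sum_le (mem (A * A^-1)%g) (rep A).
have h3 : \sum_(g in (A * A^-1)%g) rep A g ^ 2 <= energy A.
  by rewrite /energy [X in _ <= X](bigID (mem (A * A^-1)%g)) leq_addr.
rewrite -(leq_pmul2r A0) -expnSr -[4]/(2 * 2)%N expnM -h.
by apply: leq_trans h2 _; rewrite -mulnA [energy A * _]mulnC mulnA leq_mul.
Qed.

Let cardV : #|A^-1%g| = #|A|.
Proof. exact: card_invg. Qed.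

(** The lower bound for |D| is [popular_sum] applied to A^-1, which has the same energy as A. The
    last clause transfers to D, with a loss of 2 L, a bound for A on the left cosets of H. *)
Lemma popular_quotients : exists D : {set gT},
  [/\ 1%g \in D, D^-1%g = D, #|A| <= 2 * L * #|D|,
      forall G : {group gT}, A \subset G -> D \subset G &
  (forall j, #|(D ^+ j)%g| <= (2 * L ^ 2) ^ j * (L * #|A|)) /\
  (forall (H : {set gT}) g m, (forall c, #|A :&: (c *: H)%g| <= m) ->
     #|D :&: (g *: H)%g| <= 2 * L * m)].
Proof.
exists D; split.
- by rewrite inE rep1 cardV leq_pmull // muln_gt0 L0.
- by apply/setP=> g; rewrite mem_invg !inE repV.
- have hV : #|A^-1%g| ^ 3 <= L * energy A^-1 by rewrite cardV energyV.
  have A0V : 0 < #|A^-1%g| by rewrite cardV.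
  have := popular_sum (sum_rep A^-1) (rep_le A^-1) A0V hV.
  rewrite cardV (eq_bigl (mem D)) => [h|g]; last by rewrite /= inE.
  rewrite -(leq_pmul2r A0) mulnn; apply: leq_trans h _.
  rewrite -[X in _ <= X]mulnA leq_mul2l; apply/orP; right.
  by rewrite -sum_nat_const; apply: leq_sum => g _; rewrite -cardV rep_le.
- move=> G AG; apply/subsetP => g; rewrite inE => h.
  have : 0 < rep A^-1 g by have := leq_trans A0 h; rewrite !muln_gt0 => /andP[].
  case/card_gt0P=> -[u v] /setIdP[/setXP[/=]]; rewrite !mem_invg => a b /eqP <-.
  by apply: groupM; last exact: (subsetP AG); rewrite -groupV (subsetP AG).
split=> [j|H g m hm]; last first.
  rewrite -(leq_pmul2r A0).
  (* Each element of D in g H comes from at least |A| / (2L) pairs; once the first member of a pair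
     is fixed, the inverse of the second lies in A and in a single left coset of H. *)
  pose X := [set z in setX A^-1%g A^-1%g | (z.1 * z.2^-1)%g \in (g *: H)%g].
  apply: (@leq_trans (2 * L * #|X|)).
    apply: (card_fibers_ge (f := fun z => (z.1 * z.2^-1)%g)) => d /setIP[].
    rewrite inE => h dg; apply: leq_trans h _; rewrite leq_mul2l; apply/orP; right.
    apply: subset_leq_card; apply/subsetP => z /setIdP[zA /eqP e].
    by apply/setIdP; split; [apply/setIdP; rewrite e | apply/eqP].
  rewrite -[X in _ <= X]mulnA leq_mul2l [m * _]mulnC; apply/orP; right; rewrite -cardV.
  apply: (card_fibers_le (f := fun z => z.1)) => [[u v] /setIdP[/setXP[]] //|x xA].
  apply: leq_trans (hm (x^-1 * g)%g).
  rewrite -(@card_in_imset _ _ (fun z => z.2^-1)%g) => [|[a b] [c d]]; last first.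
    by case/setIdP=> _ /eqP /= -> /setIdP[_ /eqP /= ->] /invg_inj ->.
  apply: subset_leq_card; apply/subsetP => _ /imsetP[[u v] /setIdP[/setIdP[/setXP[/= _ h] /= h1]] /eqP /= e ->].
  rewrite inE -mem_invg h /= -e mem_lcoset invMg invgK -mulgA -mem_lcoset.
  by move: h1; rewrite !mem_lcoset !mulgA.
have [x xA] := card_gt0P A0.
(* Conjugation by x embeds D^j in A D^j A^-1, whose size is controlled by induction on j. *)
apply: (@leq_trans #|(A * D ^+ j * A^-1)%g|).
  rewrite -(card_imset _ (f := fun d => (x * d * x^-1)%g)); last first.
    by move=> d d' /mulIg/mulgI.
  apply: subset_leq_card; apply/subsetP => _ /imsetP[d dD ->].
  by rewrite !mem_mulg // mem_invg invgK.
(* a w d b = (a w x^-1)(y b) for each of the many ways to write d = x^-1 y. *)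
elim: j => [|j IH]; first by rewrite expg0 mulg1 mul1n.
rewrite -(leq_pmul2r A0).
apply: (@leq_trans (2 * L * #|setX (A * D ^+ j * A^-1)%g (A * A^-1)%g|)).
  apply: (card_fibers_ge (f := fun z => (z.1 * z.2)%g)) => y.
  case/mulsgP=> _ b' /mulsgP[a wd aA + ->]; rewrite expgSr mem_invg.
  case/mulsgP=> w d wD; rewrite inE => h -> b'A ->.
  apply: leq_trans h _; rewrite leq_mul2l; apply/orP; right.
  rewrite /rep -(@card_in_imset _ _ (fun z => (a * w * z.1, z.2^-1 * b')%g)); last first.
    by move=> [u v] [u' v'] _ _ [] /mulgI -> /mulIg/invg_inj ->.
  apply: subset_leq_card; apply/subsetP => _ /imsetP[[u v] /setIdP[/setXP[/= uA vA] /= /eqP e] ->].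
  apply/setIdP; split=> /=; last by rewrite -e !mulgA.
  by rewrite in_setX !mem_mulg //= -?mem_invg //; rewrite mem_invg.
rewrite cardsX expnS; apply: (@leq_trans (2 * L * ((2 * L ^ 2) ^ j * (L * #|A|) * (L * #|A|)))).
  by rewrite leq_mul2l leq_mul ?orbT.
by apply: eq_leq; rewrite -mulnn; ring.
Qed.

End Quotients.
End PopularQuotients.

(** * Two-by-two matrices *)

Section TwoByTwo.
Local Open Scope ring_scope.
Variable F : fieldType.
Implicit Types (A B d g h w x y z : 'M[F]_2) (u v : 'cV[F]_2).

Lemma big_ord2 (V : nmodType) (f : 'I_2 -> V) : \sum_i f i = f 0 + f 1.
Proof. by rewrite !big_ord_recl big_ord0 addr0; congr (_ + f _); apply/val_inj. Qed.

Lemma ord2P (P : 'I_2 -> Prop) : P 0 -> P 1 -> forall i, P i.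
Proof.
move=> P0 P1 [[|[|//]] h]; [move: P0 | move: P1]; congr P; exact/val_inj.
Qed.

Lemma mxtrace2 A : \tr A = A 0 0 + A 1 1.
Proof. exact: big_ord2. Qed.

Lemma mulmx2 n A (B : 'M[F]_(2, n)) i j : (A *m B) i j = A i 0 * B 0 j + A i 1 * B 1 j.
Proof. by rewrite mxE big_ord2. Qed.

Lemma det2 A : \det A = A 0 0 * A 1 1 - A 0 1 * A 1 0.
Proof.
rewrite (expand_det_row _ 0) big_ord2 /cofactor !det_mx11 !mxE /= !mul1r expr1 mulN1r mulrN.
by congr (_ * A _ _ - _ * A _ _); apply/val_inj.
Qed.

Lemma matrix2P A B : A 0 0 = B 0 0 -> A 0 1 = B 0 1 -> A 1 0 = B 1 0 ->
  A 1 1 = B 1 1 -> A = B.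
Proof. by move=> *; apply/matrixP => i j; move: i j; do 2! apply: ord2P. Qed.

Lemma col2P u v : u 0 0 = v 0 0 -> u 1 0 = v 1 0 -> u = v.
Proof. by move=> *; apply/matrixP => i j; rewrite (ord1 j); move: i; apply: ord2P. Qed.

Lemma col2_neq0 u : u != 0 -> (u 0 0 != 0) || (u 1 0 != 0).
Proof.
apply: contraNT; rewrite negb_or !negbK => /andP[/eqP u0 /eqP u1].
by apply/eqP/col2P; rewrite mxE.
Qed.

(** The determinant of the matrix with columns u and v. For nonzero v, [cross v (z *m v) = 0] says
    that v is an eigenvector of z without naming the eigenvalue. *)
Definition cross u v : F := u 0 0 * v 1 0 - u 1 0 * v 0 0.

Lemma crossvv v : cross v v = 0.
Proof. rewrite /cross; ring. Qed.

Lemma cross_mul A u v : cross (A *m u) (A *m v) = \det A * cross u v.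
Proof. rewrite /cross det2 !mulmx2; ring. Qed.

Lemma crossZr a u v : cross u (a *: v) = a * cross u v.
Proof. rewrite /cross !mxE; ring. Qed.

Lemma crossZl a u v : cross (a *: u) v = a * cross u v.
Proof. rewrite /cross !mxE; ring. Qed.

Lemma cross_eq0P u v : u != 0 -> reflect (exists a, v = a *: u) (cross u v == 0).
Proof.
move=> u0; apply: (iffP eqP) => [|[a ->]]; last by rewrite crossZr crossvv mulr0.
rewrite /cross => e.
case/orP: (col2_neq0 u0) => ui.
  exists (v 0 0 / u 0 0); apply: col2P; rewrite mxE; first by rewrite divfK.
  apply: (mulfI ui); rewrite mulrA [u 0 0 * (_ / _)]mulrC divfK //.
  by move/eqP: e; rewrite subr_eq0 => /eqP ->; rewrite mulrC.
exists (v 1 0 / u 1 0); apply: col2P; rewrite mxE; last by rewrite divfK.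
apply: (mulfI ui); rewrite mulrA [u 1 0 * (_ / _)]mulrC divfK //.
by move/eqP: e; rewrite subr_eq0 => /eqP <-; rewrite mulrC.
Qed.

(** Such a d has rank one, and its image, spanned by a nonzero column v, is also its kernel. Then
    tr(d z) = 0 says that d kills z v, so that z v is a multiple of v. *)
Lemma nilpotent_line d : d != 0 -> \tr d = 0 -> \det d = 0 ->
  exists2 v, v != 0 & forall z, \tr (d *m z) = 0 -> cross v (z *m v) = 0.
Proof.
move=> d0; rewrite mxtrace2 det2 => e1 e2.
have e3 : d 1 1 = - d 0 0 by apply/eqP; rewrite -addr_eq0 addrC e1.
have e4 : d 0 0 * d 0 0 = - (d 0 1 * d 1 0).
  have -> : d 0 0 * d 0 0 = - (d 0 0 * - d 0 0 - d 0 1 * d 1 0) - d 0 1 * d 1 0 by ring.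
  by rewrite -e3 e2 oppr0 add0r.
have [c0|c0] := eqVneq (col 0 d) 0; last first.
  exists (col 0 d) => // z; rewrite mxtrace2 /cross !mulmx2 !mxE => h.
  rewrite -[RHS](mulr0 (- d 1 0)) -h; ring: e3 e4.
have c1 : col 1 d != 0.
  apply: contraNneq d0 => c1.
  have E0 i : d i 0 = 0 by move/matrixP/(_ i 0): c0; rewrite !mxE.
  have E1 i : d i 1 = 0 by move/matrixP/(_ i 0): c1; rewrite !mxE.
  by apply/eqP/matrix2P; rewrite mxE ?E0 ?E1.
exists (col 1 d) => // z; rewrite mxtrace2 /cross !mulmx2 !mxE => h.
rewrite -[RHS](mulr0 (d 0 1)) -h; ring: e3 e4.
Qed.

End TwoByTwo.

(** * Fibres of the trace coordinates *)

Section TraceFibre.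
Local Open Scope ring_scope.
Variable F : fieldType.
Implicit Types (A B d g h w x y z : 'M[F]_2) (u v : 'cV[F]_2).

Lemma rank_adds_rV n (u v : 'rV[F]_n) : u != 0 -> ~~ (v <= u)%MS -> \rank (u + v)%MS = 2%N.
Proof.
move=> u0 vu; apply/eqP; rewrite eqn_leq; apply/andP; split.
  by apply: leq_trans (mxrank_adds_leqif u v).1 _; rewrite -[2%N]/(1 + 1)%N leq_add // rank_leq_row.
have -> : 2%N = (\rank u).+1 by rewrite rank_rV u0.
by apply: rank_ltmx; rewrite ltmxE addsmxSl; apply: contra vu; apply: submx_trans (addsmxSr _ _).
Qed.

(** The four entries as a row vector, so that linear dependence of matrices becomes a statement
    about ranks; pairing with [row4 d^T] is the trace form tr(d A). *)
Let row4 A : 'rV[F]_4 := \row_k [:: A 0 0; A 0 1; A 1 0; A 1 1]`_k.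

Let row4P a b A B C : row4 A = a *: row4 B + b *: row4 C -> A = a *: B + b *: C.
Proof.
move/matrixP=> e; have := (e 0 (inord 0), e 0 (inord 1), e 0 (inord 2), e 0 (inord 3)).
by rewrite !mxE !inordK // => -[[[]]] *; apply: matrix2P; rewrite !mxE.
Qed.

Let row4_mul A d : row4 A *m (row4 d^T)^T = (\tr (d *m A))%:M.
Proof.
apply/matrixP => i j; rewrite !ord1 !mxE eqxx mxtrace2 !mulmx2 !big_ord_recl big_ord0 !mxE /=.
by rewrite mulr1n; ring.
Qed.

Let row4_sub A B : (row4 A <= row4 B)%MS -> exists a, A = a *: B.
Proof.
case/sub_rVP=> a e; exists a; rewrite -[RHS]addr0 -[X in _ + X](scale0r 0).
by apply: row4P; rewrite scale0r addr0.
Qed.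

Let row4_neq0 A : A != 0 -> row4 A != 0.
Proof.
apply: contraNneq => e; have : (row4 A <= row4 0)%MS by rewrite e sub0mx.
by case/row4_sub=> a ->; rewrite scaler0.
Qed.

Lemma det_1D d : \det (1%:M + d) = 1 + \tr d + \det d.
Proof. by rewrite !det2 mxtrace2 !mxE /= !mulr1n !mulr0n; ring. Qed.

(* If d1 and d2 are proportional they are nilpotent, and a matrix z with tr(d z) = 0 for a
   nilpotent d preserves the kernel of d; otherwise w, x, y lie in the plane orthogonal to
   d1 and d2. *)
Lemma trace_fibre d1 d2 w x y : d1 != 0 -> d2 != 0 -> d1 != d2 ->
  \det (1%:M + d1) = 1 -> \det (1%:M + d2) = 1 ->
  [/\ \tr (d1 *m w) = 0, \tr (d1 *m x) = 0 & \tr (d1 *m y) = 0] ->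
  [/\ \tr (d2 *m w) = 0, \tr (d2 *m x) = 0 & \tr (d2 *m y) = 0] ->
  (exists2 v, v != 0 & [/\ cross v (w *m v) = 0, cross v (x *m v) = 0
                         & cross v (y *m v) = 0])
  \/ (w != 0 -> (forall a, x != a *: w) -> exists a b, y = a *: w + b *: x).
Proof.
move=> d10 d20 d12; rewrite !det_1D => e1 e2 [w1 x1 y1] [w2 x2 y2].
have {}e1 : \tr d1 + \det d1 = 0 by apply: (addrI 1); rewrite addrA e1 addr0.
have {}e2 : \tr d2 + \det d2 = 0 by apply: (addrI 1); rewrite addrA e2 addr0.
have [/row4_sub[c /(congr1 trmx)]|d12'] := boolP (row4 d2^T <= row4 d1^T)%MS.
  rewrite trmxK linearZ /= trmxK => e; left.
  have c0 : c != 0 by apply: contraNneq d20 => c0; rewrite e c0 scale0r.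
  have c1 : c - 1 != 0.
    by apply: contraNneq d12 => /eqP; rewrite subr_eq0 => /eqP c1; rewrite e c1 scale1r.
  (* Both d1 and c d1 satisfy tr + det = 0, so c (c - 1) det d1 = 0, with c different from 0 and
     1. *)
  have det0 : \det d1 = 0.
    apply: (mulfI c1); apply: (mulfI c0); rewrite !mulr0 -[RHS]e2 e mxtraceZ detZ.
    have -> : \tr d1 = - \det d1 by apply/eqP; rewrite -addr_eq0 e1.
    by ring.
  have tr0 : \tr d1 = 0 by rewrite -e1 det0 addr0.
  have [v v0 hv] := nilpotent_line d10 tr0 det0.
  by exists v => //; split; apply: hv.
right=> w0 xw.
have rd : \rank (row4 d1^T + row4 d2^T)%MS = 2%N.
  apply: rank_adds_rV d12'; apply: row4_neq0.
  by apply: contraNneq d10 => /(congr1 trmx); rewrite trmxK trmx0 => ->.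
have rw : \rank (row4 w + row4 x)%MS = 2%N.
  apply: rank_adds_rV (row4_neq0 w0) _.
  by apply/negP=> /row4_sub[a /eqP]; apply/negP.
have [/sub_addsmxP[[a b] /=]|yN] := boolP (row4 y <= row4 w + row4 x)%MS.
  rewrite [a]mx11_scalar [b]mx11_scalar !mul_scalar_mx => /row4P ->.
  by exists (a 0 0), (b 0 0).
(* If y lay outside the plane of w and x, a space of rank 3 would be orthogonal to one of rank 2 in
   dimension 4. *)
have ry : (2 < \rank (row4 w + row4 x + row4 y)%MS)%N.
  apply: (@leq_ltn_trans (\rank (row4 w + row4 x)%MS)); first by rewrite rw.
  apply: rank_ltmx; rewrite ltmxE addsmxSl /=.
  by apply: contra yN; apply: submx_trans (addsmxSr _ _).
have ker z : \tr (d1 *m z) = 0 -> \tr (d2 *m z) = 0 ->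
    row4 z *m (row4 d1^T + row4 d2^T)%MS^T = 0.
  move=> t1 t2; apply: trmx_inj; rewrite trmx_mul trmxK trmx0.
  apply/eqP; rewrite -sub_kermx addsmx_sub !sub_kermx.
  have e d : row4 d^T *m (row4 z)^T = (\tr (d *m z))%:M.
    by apply: trmx_inj; rewrite trmx_mul trmxK row4_mul tr_scalar_mx.
  by rewrite !e t1 t2 raddf0 eqxx.
have : (row4 w + row4 x + row4 y)%MS *m (row4 d1^T + row4 d2^T)%MS^T = 0.
  apply/eqP; rewrite -sub_kermx !addsmx_sub !sub_kermx.
  by rewrite !ker ?eqxx.
move/mulmx0_rank_max; rewrite mxrank_tr rd; lia.
Qed.

End TraceFibre.

(** * Coplanar matrices, eigenlines and commuting matrices *)

Section Lines.
Local Open Scope ring_scope.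
Variable F : finFieldType.
Implicit Types (A B d g h w x y z : 'M[F]_2) (u v : 'cV[F]_2).

Lemma det_addZ w s d :
  \det (w + s *: d) = \det w + s * (\tr w * \tr d - \tr (d *m w)) + s ^+ 2 * \det d.
Proof. rewrite !det2 !mxtrace2 !mulmx2 !mxE; ring. Qed.

Lemma mxtrace_sqr d : \tr (d *m d) = \tr d ^+ 2 - 2 * \det d.
Proof. rewrite det2 !mxtrace2 !mulmx2; ring. Qed.

Lemma coplanar_trace t w x y a b : t != 0 -> \tr w = t -> \tr x = t -> \tr y = t ->
  \det w = 1 -> \det x = 1 -> \det y = 1 -> w != x -> y = a *: w + b *: x ->
  [\/ y = w, y = x | exists2 v, v != 0 & cross v (w *m v) = 0 /\ cross v (y *m v) = 0].
Proof.
move=> t0 tw tx ty dw dx dy wx e; set d := x - w.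
have d0 : d != 0 by rewrite subr_eq0 eq_sym.
have trd : \tr d = 0 by rewrite mxtraceD raddfN /= tw tx subrr.
have ab : a = 1 - b.
  apply: (mulfI t0); rewrite mulrBr mulr1 -{2}ty e mxtraceD !mxtraceZ tw tx; ring.
have {}e : y = w + b *: d by rewrite e ab /d scalerBr scalerBl scale1r addrAC addrA.
have ex : x = w + 1 *: d by rewrite scale1r /d addrC subrK.
have e1 : \tr (d *m w) = \det d.
  move: dx; rewrite {1}ex det_addZ trd dw => /(congr1 (fun s => 1 - s + \det d)).
  by rewrite subrr add0r => h; rewrite -[RHS]h; ring.
have e2 : b * (b - 1) * \det d = 0.
  by apply: (addrI 1); rewrite addr0 -[RHS]dy e det_addZ trd dw e1; ring.
have [b0|b0] := eqVneq b 0; first by constructor 1; rewrite e b0 scale0r addr0.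
have [b1|b1] := eqVneq (b - 1) 0.
  by constructor 2; rewrite e ex; congr (_ + _ *: _); apply/eqP; rewrite -subr_eq0 b1.
have dd : \det d = 0.
  by apply/eqP; move/eqP: e2; rewrite !mulf_eq0 (negPf b0) (negPf b1).
constructor 3; have [v v0 hv] := nilpotent_line d0 trd dd.
exists v => //; split; apply: hv; first by rewrite e1.
by rewrite e mulmxDr mxtraceD e1 dd -scalemxAr mxtraceZ mxtrace_sqr trd dd; ring.
Qed.

Lemma eq_on_basis A B u v : cross u v != 0 -> A *m u = B *m u -> A *m v = B *m v -> A = B.
Proof.
move=> uv /matrixP eu /matrixP ev.
have key i j : A i j = B i j.
  apply: (mulfI uv); move: (eu i 0) (ev i 0); rewrite /cross !mulmx2 => e1 e2.
  apply/eqP; rewrite -subr_eq0; apply/eqP; move: j; apply: ord2P.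
    rewrite -[RHS](_ : v 1 0 * (A i 0 * u 0 0 + A i 1 * u 1 0 - (B i 0 * u 0 0 + B i 1 * u 1 0))
      - u 1 0 * (A i 0 * v 0 0 + A i 1 * v 1 0 - (B i 0 * v 0 0 + B i 1 * v 1 0)) = 0).
      by ring.
    by rewrite e1 e2 !subrr !mulr0 subrr.
  rewrite -[RHS](_ : u 0 0 * (A i 0 * v 0 0 + A i 1 * v 1 0 - (B i 0 * v 0 0 + B i 1 * v 1 0))
      - v 0 0 * (A i 0 * u 0 0 + A i 1 * u 1 0 - (B i 0 * u 0 0 + B i 1 * u 1 0)) = 0).
    by ring.
  by rewrite e1 e2 !subrr !mulr0 subrr.
by apply/matrixP.
Qed.

Lemma cross_decomp u v (w : 'cV[F]_2) : cross u v != 0 ->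
  w = (cross w v / cross u v) *: u + (cross u w / cross u v) *: v.
Proof.
move=> uv; apply: (scalerI uv); rewrite scalerDr !scalerA ![cross u v * (_ / _)]mulrC !divfK //.
by apply: col2P; rewrite !mxE /cross; ring.
Qed.

Lemma eigenline_eq z u v : u != 0 -> v != 0 -> cross u v = 0 ->
  cross v (z *m v) = 0 -> cross u (z *m u) = 0.
Proof.
move=> u0 v0 /eqP/cross_eq0P -/(_ u0) [a e]; rewrite e -scalemxAr crossZl crossZr => h.
have a0 : a != 0 by apply: contraNneq v0 => a0; rewrite e a0 scale0r.
by apply: (mulfI a0); apply: (mulfI a0); rewrite h !mulr0.
Qed.

Lemma two_eigenlines w : (forall a, w != a%:M) -> exists v1 v2,
  [/\ v1 != 0, v2 != 0 & forall v, v != 0 -> cross v (w *m v) = 0 ->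
      cross v1 v = 0 \/ cross v2 v = 0].
Proof.
move=> nw; have [|N] := boolP [exists v, (v != 0) && (cross v (w *m v) == 0)]; last first.
  have d0 : (delta_mx 0 0 : 'cV[F]_2) != 0.
    by apply/eqP => /matrixP/(_ 0 0); rewrite !mxE /= => /eqP; rewrite oner_eq0.
  exists (delta_mx 0 0), (delta_mx 0 0); split=> // v v0 /eqP h.
  by case/existsP: N; exists v; rewrite v0.
case/existsP=> v1 /andP[v10 e1].
have [|N] := boolP [exists v, [&& v != 0, cross v (w *m v) == 0 & cross v1 v != 0]]; last first.
  exists v1, v1; split=> // v v0 /eqP h; left; apply/eqP; apply: contraNT N => h2.
  by apply/existsP; exists v; rewrite v0 h.
case/existsP=> v2 /and3P[v20 e2 v12]; exists v1, v2; split=> // v v0 h.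
have [c1|c1] := eqVneq (cross v1 v) 0; first by left.
have [c2|c2] := eqVneq (cross v2 v) 0; first by right.
case/(cross_eq0P _ v10): e1 => l1 e1; case/(cross_eq0P _ v20): e2 => l2 e2.
have l12 : l1 = l2.
  move: h; rewrite (cross_decomp v v12).
  set a := _ / _; set b := _ / _.
  have a0 : a != 0.
    rewrite mulf_neq0 ?invr_neq0 //; move: c2; rewrite /cross.
    by rewrite -oppr_eq0 opprB [v2 1 0 * _]mulrC [v2 0 0 * _]mulrC.
  have b0 : b != 0 by rewrite mulf_neq0 ?invr_neq0.
  clearbody a b; rewrite mulmxDr -!scalemxAr e1 e2.
  have -> : cross (a *: v1 + b *: v2) (a *: (l1 *: v1) + b *: (l2 *: v2)) =
    (l2 - l1) * (a * (b * cross v1 v2)) by rewrite /cross !mxE; ring.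
  by move/eqP; rewrite !mulf_eq0 (negPf a0) (negPf b0) (negPf v12) !orbF subr_eq0 => /eqP.
case/eqP: (nw l1); apply: (eq_on_basis v12); rewrite mul_scalar_mx //.
by rewrite e2 l12.
Qed.

(** The centraliser of a nonscalar 2 x 2 matrix consists of its polynomials. The coefficient b is
    read off from a nonzero off-diagonal entry of g or, for diagonal g, from the difference of the
    diagonal entries. *)
Lemma commute_nonscalar g h : (forall a, g != a%:M) -> g *m h = h *m g ->
  exists a b, h = a%:M + b *: g.
Proof.
move=> ng /matrixP e.
have := (e 0 0, e 0 1, e 1 0, e 1 1); rewrite !mulmx2 => -[[[e00 e01] e10] e11].
have sub (p q r : F) : p + q = p + r -> q = r by apply: addrI.
have [q0|q0] := eqVneq (g 0 1) 0; last first.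
  have hb : h 0 1 = h 0 1 / g 0 1 * g 0 1 by rewrite divfK.
  set b := h 0 1 / g 0 1 in hb; exists (h 0 0 - b * g 0 0), b.
  apply: matrix2P; rewrite !mxE /= ?mulr1n ?mulr0n ?add0r //; first by rewrite subrK.
    by apply: (mulfI q0); apply: (sub (g 0 0 * h 0 0)); rewrite e00 hb; ring.
  by apply: (mulfI q0); apply: (sub (g 0 0 * h 0 1)); rewrite e01 hb; ring.
have [r0|r0] := eqVneq (g 1 0) 0; last first.
  have hb : h 1 0 = h 1 0 / g 1 0 * g 1 0 by rewrite divfK.
  set b := h 1 0 / g 1 0 in hb; exists (h 0 0 - b * g 0 0), b.
  apply: matrix2P; rewrite !mxE /= ?mulr1n ?mulr0n ?add0r //; first by rewrite subrK.
    by apply: (mulfI r0); apply: (sub (h 0 0 * g 0 0)); rewrite [g 1 0 * _]mulrC -e00 hb; ring.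
  by apply: (mulfI r0); apply: (sub (h 1 0 * g 0 0)); rewrite [g 1 0 * h 1 1]mulrC -e10 hb; ring.
have sp : g 0 0 - g 1 1 != 0.
  rewrite subr_eq0; apply/negP => /eqP e'; case/eqP: (ng (g 0 0)).
  by apply: matrix2P; rewrite !mxE /= ?q0 ?r0 -?e'.
have h01 : h 0 1 = 0.
  apply: (mulfI sp); apply: (sub (h 0 1 * g 1 1)); apply: etrans (_ : g 0 0 * h 0 1 = _); first by ring.
  by move: e01; rewrite q0 mul0r mulr0 addr0 add0r => ->; ring.
have h10 : h 1 0 = 0.
  apply: (mulfI sp); apply: (sub (g 1 1 * h 1 0)); apply: etrans (_ : h 1 0 * g 0 0 = _); first by ring.
  by move: e10; rewrite r0 mul0r mulr0 addr0 add0r => <-; ring.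
have hb : h 0 0 - h 1 1 = (h 0 0 - h 1 1) / (g 0 0 - g 1 1) * (g 0 0 - g 1 1) by rewrite divfK.
set b := (h 0 0 - h 1 1) / _ in hb; exists (h 0 0 - b * g 0 0), b.
apply: matrix2P; rewrite !mxE /= ?mulr1n ?mulr0n ?q0 ?r0 ?h01 ?h10; try by ring.
have -> : h 1 1 = h 0 0 - (h 0 0 - h 1 1) by ring.
by rewrite hb; ring.
Qed.

Lemma commute_trans g h k : (forall a, g != a%:M) -> g *m h = h *m g -> g *m k = k *m g ->
  h *m k = k *m h.
Proof.
move=> ng /(commute_nonscalar ng)[a [b ->]] /(commute_nonscalar ng)[a' [b' ->]].
by apply: matrix2P; rewrite !mulmx2 !mxE /= ?mulr1n ?mulr0n; ring.
Qed.

(** Writing z = a + b g, discriminants give b^2 (4 - (tr g)^2) = 4 - (tr z)^2. The trace thus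
    determines b up to sign, and then a, leaving at most two candidates for z. *)
Lemma commute_trace_eq g z1 z2 z3 : (2 != 0 :> F) -> \det g = 1 -> \tr g ^+ 2 != 4 ->
  (forall z, z \in [:: z1; z2; z3] -> [/\ g *m z = z *m g, \det z = 1 & \tr z = \tr z1]) ->
  z1 != z2 -> z3 = z1 \/ z3 = z2.
Proof.
move=> n2 dg tg hz z12.
have ng a : g != a%:M.
  apply: contraNneq tg => e; rewrite e mxtrace_scalar; move: dg; rewrite e det_scalar => a2.
  by rewrite -[a *+ 2]mulr_natl exprMn a2; apply/eqP; ring.
have par z : z \in [:: z1; z2; z3] -> exists a b,
    [/\ z = a%:M + b *: g, 2 * a + b * \tr g = \tr z1 & b ^+ 2 * (4 - \tr g ^+ 2) = 4 - \tr z1 ^+ 2].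
  case/hz=> /(commute_nonscalar ng)[a [b e]] dz tz; exists a, b; split=> //.
    by rewrite -tz e mxtraceD mxtrace_scalar mxtraceZ -[a *+ 2]mulr_natl.
  rewrite -tz e mxtraceD mxtrace_scalar mxtraceZ -[a *+ 2]mulr_natl.
  have : \det z = a ^+ 2 + a * b * \tr g + b ^+ 2 * \det g.
    by rewrite e !det2 mxtrace2 !mxE /= ?mulr1n ?mulr0n; ring.
  by rewrite dz dg mulr1 => e1; rewrite -[X in _ = X - _](mulr1 4) {2}e1; ring.
have [|a1 [b1 [e1 t1 q1]]] := par z1; rewrite ?inE ?eqxx //.
have [|a2 [b2 [e2 t2 q2]]] := par z2; rewrite ?inE ?eqxx ?orbT //.
have [|a3 [b3 [e3 t3 q3]]] := par z3; rewrite ?inE ?eqxx ?orbT //.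
have aE a b a' b' : 2 * a + b * \tr g = \tr z1 -> 2 * a' + b' * \tr g = \tr z1 -> b = b' -> a = a'.
  by move=> h1 h2 e; apply: (mulfI n2); apply: (addIr (b * \tr g)); rewrite h1 e h2.
have t40 : 4 - \tr g ^+ 2 != 0 by rewrite subr_eq0 eq_sym.
have sq b b' : b ^+ 2 * (4 - \tr g ^+ 2) = 4 - \tr z1 ^+ 2 ->
    b' ^+ 2 * (4 - \tr g ^+ 2) = 4 - \tr z1 ^+ 2 -> b = b' \/ b = - b'.
  move=> h1 h2; have /eqP := mulIf t40 (etrans h1 (esym h2)).
  by rewrite eqf_sqr => /orP[] /eqP; [left|right].
have b12 : b1 <> b2.
  by move=> b12; case/eqP: z12; rewrite e1 e2 b12 (aE _ _ _ _ t1 t2 b12).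
case: (sq _ _ q3 q1) => [b31|b31].
  by left; rewrite e1 e3 b31 (aE _ _ _ _ t3 t1 b31).
case: (sq _ _ q2 q1) => [/esym //|b21].
have b32 : b3 = b2 by rewrite b31.
by right; rewrite e2 e3 b32 (aE _ _ _ _ t3 t2 b32).
Qed.

End Lines.

(** * Models of SL_2 over a finite field *)

Section Model.
Local Open Scope ring_scope.
Variables (F : finFieldType) (gT : finGroupType) (G : {group gT}) (rho : gT -> 'M[F]_2).

(** A faithful two-dimensional representation that maps G onto the matrices of determinant 1. Group
    elements can thus be treated as matrices while G stays an abstract finite group. *)
Definition sl2_model : Prop :=
  [/\ injective rho, rho 1%g = 1%:M, forall g h, rho (g * h)%g = rho g *m rho h,
      {in G, forall g, \det (rho g) = 1}
    & forall A, \det A = 1 -> exists2 g, g \in G & rho g = A].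

Hypothesis rhoG : sl2_model.
Implicit Types (g h x y : gT) (u v w : 'cV[F]_2).

Lemma rho_inj : injective rho. Proof. by case: rhoG. Qed.
Lemma rho1 : rho 1%g = 1%:M. Proof. by case: rhoG. Qed.
Lemma rhoM g h : rho (g * h)%g = rho g *m rho h. Proof. by case: rhoG. Qed.
Lemma det_SL2 g : g \in G -> \det (rho g) = 1. Proof. by case: rhoG => _ _ _ + _; apply. Qed.
Lemma SL2_ex A : \det A = 1 -> exists2 g, g \in G & rho g = A. Proof. by case: rhoG => _ _ _ _; apply. Qed.

Definition cols u v : 'M[F]_2 := \matrix_(i, j) (if j == 0 then u i 0 else v i 0).

Lemma det_cols u v : \det (cols u v) = cross u v.
Proof. by rewrite det2 !mxE /= /cross; ring. Qed.

Lemma cross_ex u : u != 0 -> exists f, cross u f = 1.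
Proof.
case/col2_neq0/orP => u0.
  exists (\col_i (if i == 0 then 0 else (u 0 0)^-1)).
  by rewrite /cross !mxE /= mulr0 subr0 divff.
exists (\col_i (if i == 0 then - (u 1 0)^-1 else 0)).
by rewrite /cross !mxE /= mulr0 sub0r mulrN opprK divff.
Qed.

Lemma cols0 u v : cols u v *m delta_mx 0 0 = u.
Proof. by rewrite -colE; apply/matrixP => i j; rewrite !mxE eqxx (ord1 j). Qed.

Lemma cols1 u v : cols u v *m delta_mx 1 0 = v.
Proof. by rewrite -colE; apply/matrixP => i j; rewrite !mxE (ord1 j). Qed.

Lemma SL2_bases u v u' v' : cross u v != 0 -> cross u v = cross u' v' ->
  exists2 g, g \in G & rho g *m u = u' /\ rho g *m v = v'.
Proof.
move=> uv e; have un : cols u v \in unitmx by rewrite unitmxE det_cols unitfE.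
have [|g gS eg] := @SL2_ex (cols u' v' *m invmx (cols u v)).
  by rewrite det_mulmx det_inv !det_cols -e divff.
exists g => //; rewrite eg -{2}(cols0 u v) -{4}(cols1 u v) !mulmxA !mulmxKV //.
by rewrite cols0 cols1.
Qed.

Lemma SL2_eq g h u v : cross u v != 0 -> rho g *m u = rho h *m u ->
  rho g *m v = rho h *m v -> g = h.
Proof. by move=> uv e1 e2; apply: rho_inj; apply: (eq_on_basis uv). Qed.

(** Complete u by f with cross u f = 1. An element taking u to v is determined by the image of f,
    which runs over the affine line cross v y = 1; [phi] is a coordinate on that line. *)
Lemma card_SL2_transporter u v : u != 0 -> v != 0 ->
  #|[set g in G | rho g *m u == v]| = #|F|.
Proof.
move=> u0 v0; have [f uf] := cross_ex u0; have [w vw] := cross_ex v0.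
have uf0 : cross u f != 0 by rewrite uf oner_eq0.
pose phi g := cross w (rho g *m f).
rewrite -cardsT -(@card_in_imset _ _ phi) => [|g h].
  congr #|pred_of_set _|; apply/setP => a; rewrite [RHS]inE; apply/imsetP.
  have [|g gS [e1 e2]] := @SL2_bases u f v (w - a *: v) uf0.
    by rewrite uf -vw /cross !mxE; ring.
  exists g; first by rewrite inE gS e1 eqxx.
  rewrite /phi e2 -[LHS]mulr1 -vw /cross !mxE; ring.
case/setIdP=> gS /eqP gu /setIdP[hS /eqP hu] e.
apply: (SL2_eq uf0); first by rewrite gu hu.
have cg k : k \in G -> rho k *m u = v -> cross v (rho k *m f) = 1.
  by move=> /det_SL2 dk <-; rewrite cross_mul dk mul1r.
have d0 : cross v (rho g *m f - rho h *m f) = 0.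
  have -> : cross v (rho g *m f - rho h *m f) = cross v (rho g *m f) - cross v (rho h *m f).
    by rewrite /cross !mxE; ring.
  by rewrite !cg // subrr.
have d1 : cross w (rho g *m f - rho h *m f) = 0.
  have -> : cross w (rho g *m f - rho h *m f) = phi g - phi h.
    by rewrite /phi /cross !mxE; ring.
  by rewrite e subrr.
move/eqP: d0; case/(cross_eq0P _ v0) => a ea; move: d1; rewrite ea crossZr.
have -> : cross w v = - 1 by rewrite -vw /cross; ring.
rewrite mulrN1 => /eqP; rewrite oppr_eq0 => /eqP a0; apply/eqP.
by rewrite -subr_eq0 ea a0 scale0r.
Qed.

Lemma card_SL2 : #|G| = (#|F| * (#|F| ^ 2 - 1))%N.
Proof.
have [u u0] : exists u : 'cV[F]_2, u != 0.
  exists (delta_mx 0 0).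
  by apply/eqP => /matrixP/(_ 0 0); rewrite !mxE /= => /eqP; rewrite oner_eq0.
rewrite -(sum_card_fibers (f := fun g => rho g *m u) (Y := [set~ 0])) => [|g gS].
  rewrite (eq_bigr (fun=> #|F|)) => [|v]; last by rewrite !inE => v0; apply: card_SL2_transporter.
  by rewrite sum_nat_const cardsC1 card_mx mulnC muln1 subn1.
rewrite !inE; apply: contraNneq u0 => gu.
have uG : rho g \in unitmx by rewrite unitmxE det_SL2 // unitr1.
by rewrite -(mulKmx uG u) gu mulmx0.
Qed.

End Model.

(** * Borel subgroups, centralisers and trace classes *)

Section Stab.
Local Open Scope ring_scope.
Variables (F : finFieldType) (gT : finGroupType) (G : {group gT}) (rho : gT -> 'M[F]_2).
Hypothesis rhoG : sl2_model G rho.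
Implicit Types (g h x y z : gT) (u v w : 'cV[F]_2) (X Y : {set gT}).

(** For nonzero v, the Borel subgroup that preserves the line of v. *)
Definition line_stab v : {set gT} :=
  [set g in G | cross v (rho g *m v) == 0].

Lemma line_stabP v g : v != 0 ->
  reflect (g \in G /\ exists a, rho g *m v = a *: v) (g \in line_stab v).
Proof.
move=> v0; apply: (iffP setIdP) => -[gS h]; split=> //; exact/(cross_eq0P _ v0).
Qed.

Lemma line_stab_group_set v : v != 0 -> group_set (line_stab v).
Proof.
move=> v0; apply/group_setP; split=> [|x y /(line_stabP _ v0)[xS [a ha]] /(line_stabP _ v0)[yS [b hb]]].
  by apply/(line_stabP _ v0); split; [exact: group1 | exists 1; rewrite (rho1 rhoG) mul1mx scale1r].
apply/(line_stabP _ v0); split; first exact: groupM.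
by exists (b * a); rewrite (rhoM rhoG) -mulmxA hb -scalemxAr ha scalerA.
Qed.

Lemma SL2_shears : exists g h : gT, [/\ g \in G, h \in G,
  rho g = 1%:M + delta_mx 0 1 & rho h = 1%:M + delta_mx 1 0].
Proof.
have [|g gS eg] := @SL2_ex _ _ _ _ rhoG (1%:M + delta_mx 0 1).
  by rewrite det2 !mxE /= ?mulr1n ?mulr0n; ring.
have [|h hS eh] := @SL2_ex _ _ _ _ rhoG (1%:M + delta_mx 1 0).
  by rewrite det2 !mxE /= ?mulr1n ?mulr0n; ring.
by exists g, h.
Qed.

(** No line is preserved by both elementary shears. *)
Lemma line_stab_proper v : v != 0 -> line_stab v \proper G.
Proof.
move=> v0; rewrite properE; apply/andP; split; first by apply/subsetP=> g /setIdP[].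
have [g [h [gS hS eg eh]]] := SL2_shears.
apply/negP => /subsetP sub; move: (sub g gS) (sub h hS).
case/setIdP=> _ /eqP + /setIdP[_ /eqP].
rewrite eg eh /cross !mulmx2 !mxE /= ?mulr1n ?mulr0n.
rewrite !(mul1r, mul0r, add0r, addr0) => e1 e2.
case/col2_neq0/orP: v0 => /negP; apply.
  rewrite -sqrf_eq0 -[X in X == _](_ : v 0 0 * (v 0 0 + v 1 0) - v 1 0 * v 0 0 = v 0 0 ^+ 2).
    by rewrite e2.
  by ring.
rewrite -sqrf_eq0 -oppr_eq0 -[X in X == _](_ : v 0 0 * v 1 0 - v 1 0 * (v 0 0 + v 1 0) = - v 1 0 ^+ 2).
  by rewrite e1.
by ring.
Qed.

Definition nonscalar g := forall a, rho g != a%:M.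

(** A matrix commuting with both elementary shears is scalar. *)
Lemma cent_proper g : nonscalar g -> 'C_(G)[g] \proper G.
Proof.
move=> ng; rewrite properE subsetIl /=.
have [k [h [kS hS ek eh]]] := SL2_shears.
apply/negP => /subsetP sub; move: (sub k kS) (sub h hS).
case/setIP=> _ /cent1P e1 /setIP[_ /cent1P e2].
move/(congr1 rho): e1; move/(congr1 rho): e2.
rewrite !(rhoM rhoG) ek eh => /matrixP e2 /matrixP e1.
case/eqP: (ng (rho g 0 0)).
have := (e1 0 0, e1 0 1, e2 0 0, e2 0 1); rewrite !mulmx2 !mxE /= ?mulr1n ?mulr0n.
rewrite !(mul1r, mulr1, mul0r, mulr0, add0r, addr0) => -[[[a b] c] _].
have g10 : rho g 1 0 = 0 by apply: (addrI (rho g 0 0)); rewrite addr0.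
have g01 : rho g 0 1 = 0 by apply: (addrI (rho g 0 0)); rewrite addr0.
apply: matrix2P; rewrite !mxE /= ?mulr1n ?mulr0n ?g10 ?g01 //.
by move: b; rewrite g01 add0r addr0 => ->.
Qed.

Lemma det_1_eigen g t a v : g \in G -> \tr (rho g) = t -> v != 0 ->
  rho g *m v = a *: v -> a ^+ 2 - t * a + 1 = 0.
Proof.
move=> gS tg v0 e; have dg := det_SL2 rhoG gS.
have key w : rho g *m (rho g *m w) - t *: (rho g *m w) + w = 0.
  move: dg tg; rewrite det2 mxtrace2 => dg <-.
  apply: col2P; rewrite !mxE !big_ord2 !mxE !big_ord2.
    rewrite -[X in _ + X = _]mul1r -dg; ring.
  rewrite -[X in _ + X = _]mul1r -dg; ring.
have := key v; rewrite e -scalemxAr e => /matrixP h; apply/eqP.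
have hi i : (a ^+ 2 - t * a + 1) * v i 0 = 0.
  by have := h i 0; rewrite !mxE => <-; ring.
by case/col2_neq0/orP: v0 => vi; rewrite -(mulIr_eq0 _ (mulIf vi)) hi.
Qed.

(* x'^-1 x fixes v, and x g y = x' g y' makes it fix g v as well. *)
Lemma card_eigen_sq X a v g : v != 0 -> g \in G -> g \notin line_stab v ->
  {in X, forall x, rho x *m v = a *: v} ->
  (#|X| ^ 2 <= #|(X * [set g] * X)%g|)%N.
Proof.
move=> v0 gS gv hX; rewrite -mulnn -cardsX.
rewrite -(@card_in_imset _ _ (fun q => (q.1 * g * q.2)%g)); last first.
  move=> [x y] [x' y'] /setXP[/= xX yX] /setXP[/= xX' yX'] e.
  have cgv : cross v (rho g *m v) != 0 by apply: contra gv => h; apply/setIdP.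
  have fix_v (s s' : gT) : s \in X -> s' \in X -> rho (s'^-1 * s)%g *m v = v.
    move=> sX s'X; rewrite (rhoM rhoG) -mulmxA hX // -(hX s') // mulmxA -(rhoM rhoG) mulVg.
    by rewrite (rho1 rhoG) mul1mx.
  have fix_v' (s s' : gT) : s \in X -> s' \in X -> rho (s' * s^-1)%g *m v = v.
    move=> sX s'X; have a0 : a != 0.
      apply: contraNneq v0 => a0; have := hX s sX; rewrite a0 scale0r => s0.
      by rewrite -[v]mul1mx -(rho1 rhoG) -(mulVg s) (rhoM rhoG) -mulmxA s0 mulmx0.
    apply: (scalerI a0); rewrite scalemxAr -(hX s) // mulmxA -(rhoM rhoG) mulgKV.
    by rewrite !hX.
  have e1 : (x'^-1 * x)%g = (g * (y' * y^-1) * g^-1)%g.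
    have ex : x = (x' * g * y' * y^-1 * g^-1)%g by move: e => /= <-; rewrite !mulgK.
    by rewrite {1}ex !mulgA mulVg mul1g.
  have e2 : (x'^-1 * x)%g = 1%g.
    apply: (rho_inj rhoG); rewrite (rho1 rhoG); apply: (eq_on_basis cgv); rewrite mul1mx ?fix_v //.
    by rewrite e1 mulmxA -(rhoM rhoG) mulgKV (rhoM rhoG) -mulmxA fix_v'.
  have exx : x = x' by apply: (mulgI (x'^-1)%g); rewrite e2 mulVg.
  by subst x'; congr (_, _); apply: (mulgI (x * g)%g); exact: e.
apply: subset_leq_card; apply/subsetP => _ /imsetP[[x y] /setXP[/= xX yX] ->].
by rewrite !mem_mulg // inE.
Qed.

Lemma sqr_le_4 (i j k m : nat) : (k <= i + j -> i ^ 2 <= m -> j ^ 2 <= m -> k ^ 2 <= 4 * m)%N.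
Proof.
move=> h1 h2 h3; have h4 : (k ^ 2 <= (i + j) ^ 2)%N by rewrite leq_exp2r.
have h5 : (2 * (i * j) <= i ^ 2 + j ^ 2)%N := nat_Cauchy i j.
by apply: leq_trans h4 _; rewrite sqrnD; lia.
Qed.

(** An element of trace t preserving the line of v acts on it by a root of a^2 - t a + 1, hence by
    a0 or t - a0. Each of the two parts is bounded by [card_eigen_sq]. *)
Lemma card_class_stab X t v g : v != 0 -> g \in G -> g \notin line_stab v ->
  X \subset line_stab v -> {in X, forall x, \tr (rho x) = t} ->
  (#|X| ^ 2 <= 4 * #|(X * [set g] * X)%g|)%N.
Proof.
move=> v0 gS gv /subsetP sX tX.
have [->|[x0 x0X]] := set_0Vmem X; first by rewrite cards0.
have [x0S [a0 e0]] := line_stabP _ v0 (sX _ x0X).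
have q0 := det_1_eigen x0S (tX _ x0X) v0 e0.
pose E a := [set x in X | rho x *m v == a *: v].
have EX a : E a \subset X by apply/subsetP=> x /setIdP[].
have bE a : (#|E a| ^ 2 <= #|(X * [set g] * X)%g|)%N.
  have := card_eigen_sq (X := E a) v0 gS gv; move=> /(_ a) h.
  apply: leq_trans (h _) _; first by move=> x /setIdP[_ /eqP].
  by apply: subset_leq_card; rewrite mulgSS ?mulSg.
have XE : X \subset E a0 :|: E (t - a0).
  apply/subsetP=> x xX; have [xS [a e]] := line_stabP _ v0 (sX _ xX).
  have q := det_1_eigen xS (tX _ xX) v0 e.
  have : (a - a0) * (a - (t - a0)) = 0.
    by rewrite -[RHS](subrr 0) -{1}q -q0; ring.
  move/eqP; rewrite mulf_eq0 !subr_eq0 inE !inE xX e /= => /orP[] /eqP ->.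
    by rewrite eqxx.
  by rewrite eqxx orbT.
have h1 := leq_trans (subset_leq_card XE) (leq_card_setU _ _).1.
exact: sqr_le_4 h1 (bE a0) (bE (t - a0)).
Qed.

End Stab.

(** * Bounding a trace class by counting triples *)

Section ClassBound.
Local Open Scope ring_scope.
Variables (F : finFieldType) (gT : finGroupType) (G : {group gT}) (rho : gT -> 'M[F]_2).
Hypothesis rhoG : sl2_model G rho.
Implicit Types (g h w x y : gT) (u v : 'cV[F]_2) (X Y : {set gT}).

Section Triples.
Variables (X : {set gT}) (t : F) (b : nat).
Hypotheses (t0 : t != 0) (XS : X \subset G).
Hypothesis tX : {in X, forall x, \tr (rho x) = t}.
Hypothesis nX : {in X, forall x, nonscalar rho x}.
Hypothesis bX : forall v, v != 0 -> (#|X :&: line_stab G rho v| <= b)%N.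

Let common_line w y := [exists v, [&& v != 0, w \in line_stab G rho v & y \in line_stab G rho v]].

(* Two triples with the same quotients w^-1 x, w^-1 y differ by a left translation h; the
   matrices h - 1 are orthogonal to w, x, y, which is the situation of [trace_fibre]. *)
Let bad w x y := [|| x == w, y == w, y == x | common_line w y].

(** The nonscalar w has at most two eigenlines, and each of their stabilisers contains at most b
    elements of X. *)
Let card_common w : w \in X -> (#|[set y in X | common_line w y]| <= 2 * b)%N.
Proof.
move=> wX; have [v1 [v2 [v10 v20 h]]] := two_eigenlines (nX wX).
have sub : [set y in X | common_line w y] \subset
    (X :&: line_stab G rho v1) :|: (X :&: line_stab G rho v2).
  apply/subsetP=> y /setIdP[yX /existsP[v /and3P[v0 /setIdP[_ /eqP ew] /setIdP[yS /eqP ey]]]].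
  case: (h v v0 ew) => c; apply/setUP; [left|right]; apply/setIP; split=> //.
    by apply/setIdP; split=> //; apply/eqP; apply: eigenline_eq c ey.
  by apply/setIdP; split=> //; apply/eqP; apply: eigenline_eq c ey.
apply: leq_trans (subset_leq_card sub) _; apply: leq_trans (leq_card_setU _ _).1 _.
by rewrite mul2n -addnn leq_add // bX.
Qed.

Let T := setX X (setX X X).
Let Bad := [set q in T | bad q.1 q.2.1 q.2.2].

(** Each of the three coincidences leaves two free entries; in the fourth case w and x are free and
    y has at most 2b choices. *)
Let card_bad : (#|Bad| <= #|X| ^ 2 * (3 + 2 * b))%N.
Proof.
pose B1 := [set (q.1, (q.1, q.2)) | q in setX X X].
pose B2 := [set (q.1, (q.2, q.1)) | q in setX X X].
pose B3 := [set (q.1, (q.2, q.2)) | q in setX X X].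
pose B4 := [set q in T | common_line q.1 q.2.2].
have cX : #|setX X X| = (#|X| ^ 2)%N by rewrite cardsX mulnn.
have c4 : (#|B4| <= #|X| ^ 2 * (2 * b))%N.
  rewrite -cX; apply: (card_fibers_le (f := fun q => (q.1, q.2.1))).
    by move=> [w [x y]] /setIdP[/setXP[wX /setXP[/= xX _]] _]; apply/setXP.
  move=> [w x] /setXP[wX _]; apply: leq_trans (card_common wX).
  rewrite -(@card_in_imset _ _ (fun q => q.2.2)); last first.
    by move=> [? [? y]] [? [? y']] /setIdP[_ /eqP /= [-> ->]] /setIdP[_ /eqP /= [-> ->]] ->.
  apply: subset_leq_card; apply/subsetP => _ /imsetP[[w' [x' y]] h ->] /=.
  case/setIdP: h => /setIdP[/setXP[_ /setXP[_ yX]] c] /eqP[ew _].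
  by apply/setIdP; split=> //; rewrite -ew.
have sub : Bad \subset B1 :|: B2 :|: B3 :|: B4.
  apply/subsetP=> -[w [x y]] /setIdP[h] /=; have := h.
  move=> /setXP[/= wX /setXP[/= xX yX]] /or4P[/eqP e|/eqP e|/eqP e|c]; rewrite !in_setU -!orbA.
  - by apply/orP; left; apply/imsetP; exists (w, y); rewrite ?in_setX ?wX //= e.
  - by rewrite orbC -!orbA; apply/orP; left; apply/imsetP; exists (w, x); rewrite ?in_setX ?wX //= e.
  - by apply/or4P; constructor 3; apply/imsetP; exists (w, x); rewrite ?in_setX ?wX //= e.
  - by apply/or4P; constructor 4; apply/setIdP.
apply: leq_trans (subset_leq_card sub) _; apply: leq_trans (leq_card_setU _ _).1 _.
rewrite mulnDr leq_add //; apply: leq_trans (leq_card_setU _ _).1 _.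
rewrite !mulnS muln0 addn0 addnA leq_add //; last by rewrite -cX leq_imset_card.
apply: leq_trans (leq_card_setU _ _).1 _.
by rewrite leq_add // -cX leq_imset_card.
Qed.

Let card_good : (#|T :\: Bad| <= 2 * #|(X^-1 * X)%g| ^ 2)%N.
Proof.
rewrite mulnC -mulnn -cardsX.
apply: (card_fibers_le (f := fun q => (q.1^-1 * q.2.1, q.1^-1 * q.2.2)%g)).
  move=> [w [x y]] /setDP[/setXP[/= wX /setXP[/= xX yX]] _].
  by apply/setXP; rewrite !mem_mulg // mem_invg invgK.
move=> z _; rewrite leqNgt; apply/negP => /card_gt2P.
move=> [[w [x y]] [[w1 [x1 y1]] [[w2 [x2 y2]] [[]]]]].
case/setIdP=> /setDP[/setXP[/= wX /setXP[/= xX yX]] nbad] /eqP <-.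
case/setIdP=> /setDP[/setXP[/= w1X /setXP[/= x1X y1X]] _].
rewrite xpair_eqE => /andP[/eqP/= ex1 /eqP/= ey1].
case/setIdP=> /setDP[/setXP[/= w2X /setXP[/= x2X y2X]] _].
rewrite xpair_eqE => /andP[/eqP/= ex2 /eqP/= ey2] [n01 n12 n20].
have {}nbad : ~~ bad w x y.
  by apply: contra nbad => h; apply/setIdP; split; rewrite ?in_setX ?wX ?xX.
(* Three triples over the same quotients are the translates of the first by 1, h1 and h2; as they
   differ, h1 - 1 and h2 - 1 are nonzero and distinct. *)
pose h1 := (w1 * w^-1)%g; pose h2 := (w2 * w^-1)%g.
have hw1 : w1 = (h1 * w)%g by rewrite mulgKV.
have hw2 : w2 = (h2 * w)%g by rewrite mulgKV.
have hx1 : x1 = (h1 * x)%g by rewrite /h1 -mulgA -ex1 mulKVg.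
have hx2 : x2 = (h2 * x)%g by rewrite /h2 -mulgA -ex2 mulKVg.
have hy1 : y1 = (h1 * y)%g by rewrite /h1 -mulgA -ey1 mulKVg.
have hy2 : y2 = (h2 * y)%g by rewrite /h2 -mulgA -ey2 mulKVg.
pose d h := rho h - 1%:M.
have dE h : 1%:M + d h = rho h by rewrite addrC subrK.
have d1 : d h1 != 0.
  rewrite subr_eq0 -(rho1 rhoG); apply: contra n01 => /eqP/(rho_inj rhoG) e.
  by rewrite hw1 hx1 hy1 e !mul1g.
have d2 : d h2 != 0.
  rewrite subr_eq0 -(rho1 rhoG); apply: contra n20 => /eqP/(rho_inj rhoG) e.
  by rewrite hw2 hx2 hy2 e !mul1g.
have d12 : d h1 != d h2.
  apply: contra n12 => /eqP/addIr/(rho_inj rhoG) e.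
  by rewrite hw1 hx1 hy1 hw2 hx2 hy2 e.
have inS x' : x' \in X -> x' \in G := subsetP XS x'.
have dd h x' : x' \in X -> (h * x')%g \in X -> \tr (d h *m rho x') = 0.
  by move=> xX' hX'; rewrite mulmxBl mul1mx -(rhoM rhoG) raddfB /= (tX hX') (tX xX') subrr.
have hS h : h \in G -> \det (1%:M + d h) = 1 by rewrite dE; apply: (det_SL2 rhoG).
have h1S : h1 \in G := groupM (inS _ w1X) (groupVr (inS _ wX)).
have h2S : h2 \in G := groupM (inS _ w2X) (groupVr (inS _ wX)).
have e1 : [/\ \tr (d h1 *m rho w) = 0, \tr (d h1 *m rho x) = 0 & \tr (d h1 *m rho y) = 0].
  by split; apply: dd; rewrite -?hw1 -?hx1 -?hy1.
have e2 : [/\ \tr (d h2 *m rho w) = 0, \tr (d h2 *m rho x) = 0 & \tr (d h2 *m rho y) = 0].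
  by split; apply: dd; rewrite -?hw2 -?hx2 -?hy2.
case: (trace_fibre d1 d2 d12 (hS _ h1S) (hS _ h2S) e1 e2) => [[v v0 [cw cx cy]]|dep].
  case/negP: nbad; apply/or4P; constructor 4; apply/existsP; exists v; rewrite v0 /=.
  by apply/andP; split; apply/setIdP; rewrite inS //; split=> //; apply/eqP.
have w0 : rho w != 0 by apply: contraNneq (nX wX 0) => ->; rewrite raddf0.
have xw a : rho x != a *: rho w.
  apply: contra nbad => /eqP e; apply/or4P; constructor 1.
  have a1 : a = 1 by apply: (mulIf t0); rewrite mul1r -{2}(tX xX) e mxtraceZ tX.
  by apply/eqP; apply: (rho_inj rhoG); rewrite e a1 scale1r.
have [a [c e]] := dep w0 xw.
have wx : rho w != rho x.
  by apply: contra nbad => /eqP/(rho_inj rhoG) ->; rewrite /bad eqxx.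
case: (coplanar_trace t0 (tX wX) (tX xX) (tX yX) (det_SL2 rhoG (inS _ wX)) (det_SL2 rhoG (inS _ xX))
  (det_SL2 rhoG (inS _ yX)) wx e) => [/(rho_inj rhoG) e'|/(rho_inj rhoG) e'|[v v0 [cw cy]]].
- by move: nbad; rewrite /bad e' eqxx orbT.
- by move: nbad; rewrite /bad e' eqxx !orbT.
case/negP: nbad; apply/or4P; constructor 4; apply/existsP; exists v; rewrite v0 /=.
by apply/andP; split; apply/setIdP; rewrite inS //; split=> //; apply/eqP.
Qed.

Lemma class_bound : (#|X| ^ 3 <= #|X| ^ 2 * (3 + 2 * b) + 2 * #|(X^-1 * X)%g| ^ 2)%N.
Proof.
have -> : (#|X| ^ 3 = #|T|)%N by rewrite !cardsX !expnS expn0 muln1.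
rewrite -(cardsID Bad T) leq_add //; apply: leq_trans card_bad.
by apply: subset_leq_card; apply: subsetIr.
Qed.

End Triples.
End ClassBound.

Section SetPowers.
Variable gT : finGroupType.
Implicit Types (A D : {set gT}).
Local Open Scope group_scope.

Lemma sub_expg D i j : 1 \in D -> (i <= j)%N -> D ^+ i \subset D ^+ j.
Proof.
move=> D1 /subnKC <-; rewrite expgD; apply: mulg_subl.
elim: (j - i)%N => [|k IH]; first by rewrite expg0 set11.
by rewrite expgS -[1]mulg1 mem_mulg.
Qed.

Lemma sym_expg D j : D^-1 = D -> (D ^+ j)^-1 = D ^+ j.
Proof.
move=> DV; elim: j => [|j IH]; first by rewrite expg0 invg1.
by rewrite [in LHS]expgS expgSr invMg IH DV.
Qed.

End SetPowers.

(** * Regular elements and maximal tori *)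

Section Product.
Local Open Scope ring_scope.
Variables (F : finFieldType) (gT : finGroupType) (G : {group gT}) (rho : gT -> 'M[F]_2).
Hypothesis rhoG : sl2_model G rho.
Hypothesis char_neq2 : (2 != 0 :> F).
Implicit Types (g h x y z : gT) (u v : 'cV[F]_2) (A D X Y : {set gT}).
Local Notation tr g := (\tr (rho g)).

(** Trace 0 is excluded for the counting of triples, and traces 2 and -2 so that the centraliser is
    a maximal torus on which each trace occurs at most twice. *)
Definition regular g := tr g \notin [:: 0; 2; -2].

Lemma regular_tr g : regular g -> tr g != 0 /\ tr g ^+ 2 != 4.
Proof.
rewrite /regular !inE !negb_or => /and3P[t0 t2 t3]; split=> //.
rewrite (_ : 4 = 2 ^+ 2); last by ring.
by rewrite eqf_sqr negb_or t2 t3.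
Qed.

Lemma regular_nonscalar g : g \in G -> tr g ^+ 2 != 4 -> nonscalar rho g.
Proof.
move=> gG t4 a; apply: contraNneq t4 => e.
have := det_SL2 rhoG gG; rewrite e det_scalar mxtrace_scalar => a2.
by rewrite -[a *+ 2]mulr_natl exprMn a2; apply/eqP; ring.
Qed.

Lemma tr_conj g x : tr (x * g * x^-1)%g = tr g.
Proof.
by rewrite !(rhoM rhoG) mxtrace_mulC mulmxA -(rhoM rhoG) mulVg (rho1 rhoG) mul1mx.
Qed.

Lemma regular_conj g x : regular (x * g * x^-1)%g = regular g.
Proof. by rewrite /regular tr_conj. Qed.

Lemma sl2_centP g z : reflect (z \in G /\ rho g *m rho z = rho z *m rho g) (z \in 'C_G[g]%g).
Proof.
apply: (iffP setIP) => -[zG e]; split=> //; rewrite -?(rhoM rhoG).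
  by move/cent1P: e => ->.
by apply/cent1P; apply: (rho_inj rhoG); rewrite !(rhoM rhoG).
Qed.

Lemma card_cent_traces g (T : {set F}) : g \in G -> tr g ^+ 2 != 4 ->
  (#|[set z in 'C_G[g]%g | tr z \in T]| <= #|T| * 2)%N.
Proof.
move=> gG t4; apply: (card_fibers_le (f := fun z => tr z)) => [z /setIdP[]//|t _].
rewrite leqNgt; apply/negP => /card_gt2P[z1 [z2 [z3 [[]]]]].
case/setIdP=> /setIdP[/sl2_centP[G1 c1] _] /eqP t1.
case/setIdP=> /setIdP[/sl2_centP[G2 c2] _] /eqP t2.
case/setIdP=> /setIdP[/sl2_centP[G3 c3] _] /eqP t3 [n12 n23 n31].
have [||e|e] := @commute_trace_eq _ (rho g) (rho z1) (rho z2) (rho z3) char_neq2 (det_SL2 rhoG gG) t4.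
- move=> z; rewrite !inE => /or3P[] /eqP ->.
  + by split=> //; exact: (det_SL2 rhoG G1).
  + by split=> //; [exact: (det_SL2 rhoG G2) | rewrite t1 t2].
  + by split=> //; [exact: (det_SL2 rhoG G3) | rewrite t1 t3].
- by apply: contra n12 => /eqP/(rho_inj rhoG) ->.
- by case/eqP: n31; apply: (rho_inj rhoG).
- by case/eqP: n23; apply: (rho_inj rhoG).
Qed.

Lemma card_cent g : g \in G -> tr g ^+ 2 != 4 -> (#|'C_G[g]%g| <= 2 * #|F|)%N.
Proof.
move=> gG t4; have := card_cent_traces [set: F] gG t4; rewrite cardsT mulnC.
by congr (_ <= _)%N; congr #|pred_of_set _|; apply/setP => z; rewrite !inE ?andbT.
Qed.

Lemma card_cent_nonregular g : g \in G -> tr g ^+ 2 != 4 ->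
  (#|[set z in 'C_G[g]%g | ~~ regular z]| <= 6)%N.
Proof.
move=> gG t4; pose T := [set x in [:: 0; 2; -2 : F]].
have T6 : (#|T| * 2 <= 6)%N by rewrite cardsE -[6%N]/(3 * 2)%N leq_mul2r /= card_size.
apply: leq_trans T6; apply: leq_trans (card_cent_traces _ gG t4); apply: subset_leq_card.
apply/subsetP=> z /setIdP[zC]; rewrite negbK => h; apply/setIdP; split=> //.
by rewrite inE.
Qed.

Lemma cent_trans g h : g \in G -> tr g ^+ 2 != 4 -> h \in 'C_G[g]%g ->
  forall z, z \in 'C_G[g]%g -> z \in 'C_G[h]%g.
Proof.
move=> gG t4 /sl2_centP[hG eh] z /sl2_centP[zG ez]; apply/sl2_centP; split=> //.
exact: commute_trans (regular_nonscalar gG t4) eh ez.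
Qed.

(** Commuting is transitive through nonscalar elements, so a torus is the centraliser of each of its
    elements with trace other than 2 and -2. *)
Lemma cent_eq g h : g \in G -> tr g ^+ 2 != 4 -> h \in G -> tr h ^+ 2 != 4 -> h \in 'C_G[g]%g ->
  'C_G[g]%g = 'C_G[h]%g.
Proof.
move=> gG g4 hG h4 hg; apply/setP => z; apply/idP/idP; first exact: cent_trans.
apply: cent_trans => //; case/sl2_centP: hg => _ e; exact/sl2_centP.
Qed.

End Product.

(** * The product theorem *)

(** Either N <= 2 (3 + 2b), and the bound on b applies, or the term in N^2 is at most half of N^3
    and N^3 <= 4 Z^2. The exponents are 12 + 2 x 44 = 100 and 2 + 2 x 39 = 80. *)
Lemma class_arith (N b Z d L : nat) : (1 < L -> 0 < d ->
  N ^ 3 <= N ^ 2 * (3 + 2 * b) + 2 * Z ^ 2 ->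
  b ^ 2 <= L ^ 44 * d -> Z <= L ^ 39 * d -> N ^ 3 <= L ^ 100 * d ^ 2)%N.
Proof.
move=> L2 d0 h hb hZ; have L0 : (0 < L)%N by apply: ltnW.
have Lge j : (2 ^ j <= L ^ j)%N by case: j => // j; rewrite leq_exp2r.
have [le|gt] := leqP N (2 * (3 + 2 * b)).
  (* Since c >= 1, c^3 is at most c^4, which the bound on c^2 controls. *)
  pose c := maxn b 1; have c0 : (0 < c)%N by rewrite leq_max orbT.
  have hc : (c ^ 2 <= L ^ 44 * d)%N.
    by rewrite /c; case: (leqP b 1%N) => // _; rewrite exp1n muln_gt0 expn_gt0 L0.
  have hN : (N <= 10 * c)%N.
    apply: leq_trans le _; have : (b <= c)%N by rewrite leq_max leqnn.
    by move: c0; clearbody c; clear -c; lia.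
  have h3 : (N ^ 3 <= 2 ^ 10 * (c ^ 2) ^ 2)%N.
    apply: leq_trans (_ : (10 * c) ^ 3 <= _)%N; first by rewrite leq_exp2r.
    rewrite expnMn -expnM; apply: leq_mul => //.
    by rewrite leq_pexp2l.
  apply: leq_trans h3 _; rewrite -[100%N]/(12 + 44 * 2)%N expnD -mulnA expnM -expnMn.
  apply: leq_mul; last by rewrite leq_exp2r.
  by apply: leq_trans (Lge 10%N) _; rewrite leq_pexp2l.
have h1 : (N ^ 2 * (2 * (3 + 2 * b)) <= N ^ 3)%N by rewrite [X in (_ <= X)%N]expnSr leq_mul2l (ltnW gt) orbT.
have h2 : (N ^ 3 <= 2 ^ 2 * Z ^ 2)%N.
  rewrite mulnCA in h1; move: h h1.
  by move: (N ^ 3)%N (N ^ 2 * _)%N (Z ^ 2)%N => x y z; clear; lia.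
apply: leq_trans h2 _; apply: leq_trans (_ : L ^ 2 * (L ^ 39 * d) ^ 2 <= _)%N.
  by apply: leq_mul; rewrite ?leq_exp2r.
by rewrite expnMn -expnM mulnA -expnD leq_mul2r leq_pexp2l ?orbT.
Qed.

Section ProductTheorem.
Local Open Scope ring_scope.
Variables (F : finFieldType) (gT : finGroupType) (G : {group gT}) (rho : gT -> 'M[F]_2).
Hypothesis rhoG : sl2_model G rho.
Hypothesis char_neq2 : (2 != 0 :> F).
Implicit Types (g h x y z : gT) (u v : 'cV[F]_2) (X Y : {set gT}).
Local Notation tr g := (\tr (rho g)).
Local Notation regular := (regular rho).
Local Notation q := #|F|.

Variables (D : {set gT}) (L e : nat).
Hypothesis e_ge : (120 <= e)%N.
Hypotheses (L2 : (1 < L)%N) (DG : D \subset G) (D1 : 1%g \in D) (DV : (D^-1 = D)%g).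
Hypothesis powD : forall j, (#|(D ^+ j)%g| <= L ^ (3 * j + 3) * #|D|)%N.
Hypothesis conD : forall H : {group gT}, H \proper G -> (L ^ e * #|D :&: H| <= #|D|)%N.
Hypotheses (largeD : (L ^ e <= #|D|)%N) (smallD : (L ^ e * #|D| <= q ^ 3)%N).

Let d := #|D|.

Let d0 : (0 < d)%N.
Proof. by apply/card_gt0P; exists 1%g. Qed.

Let powG j : (D ^+ j)%g \subset G.
Proof. by elim: j => [|j IH]; rewrite ?expg0 ?sub1G // expgS mul_subG. Qed.

Let mem_pow j x : x \in (D ^+ j)%g -> x \in G.
Proof. exact: (subsetP (powG j)). Qed.

Let powM i j x y : x \in (D ^+ i)%g -> y \in (D ^+ j)%g -> (x * y)%g \in (D ^+ (i + j))%g.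
Proof. by rewrite expgD; apply: mem_mulg. Qed.

Let powV j x : x \in (D ^+ j)%g -> (x^-1)%g \in (D ^+ j)%g.
Proof. by move=> xD; rewrite -(sym_expg j DV) mem_invg invgK. Qed.

Let mem1 x : x \in D -> x \in (D ^+ 1)%g.
Proof. by rewrite expg1. Qed.

Let Lge j : (2 ^ j <= L ^ j)%N.
Proof. by case: j => // j; rewrite leq_exp2r. Qed.

Let Lmono i j : (i <= j -> L ^ i <= L ^ j)%N.
Proof. by apply: leq_pexp2l; apply: ltnW. Qed.

(** Each proper subgroup contains at most a quarter of D, so three of them cannot cover it. *)
Let avoid (H1 H2 H3 : {group gT}) : H1 \proper G -> H2 \proper G -> H3 \proper G ->
  exists x, [/\ x \in D, x \notin H1, x \notin H2 & x \notin H3].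
Proof.
move=> /conD h1 /conD h2 /conD h3.
have [|N] := boolP (D \subset (D :&: H1) :|: (D :&: H2) :|: (D :&: H3)); last first.
  have /subsetPn[x xD] := N; rewrite !in_setU !in_setI xD /= !negb_or -andbA => /and3P[].
  by exists x.
move/subset_leq_card => h.
have e1 := (leq_card_setU (D :&: H1 :|: D :&: H2) (D :&: H3)).1.
have e2 := (leq_card_setU (D :&: H1) (D :&: H2)).1.
have L4 : (4 <= L ^ e)%N by apply: leq_trans (_ : 2 ^ 2 <= _)%N => //; apply: leq_trans (Lge 2) (Lmono (leq_trans _ e_ge)).
have l (k : nat) : (L ^ e * k <= d -> 4 * k <= d)%N by apply: leq_trans; rewrite leq_mul2r L4 orbT.
move/l: h1 => h1; move/l: h2 => h2; move/l: h3 => h3.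
have := leq_trans h (leq_trans e1 (leq_add e2 (leqnn _))).
by move: d0 h1 h2 h3; rewrite -/d; lia.
Qed.

Let generates : <<D>>%g = G :> {set gT}.
Proof.
have sub : <<D>>%g \subset G by rewrite gen_subG.
apply/eqP; rewrite eqEsubset sub /=; apply: contraT => N.
have := conD (_ : <<D>>%G \proper G); rewrite properE sub N => /(_ isT).
rewrite (setIidPl (subset_gen D)) -/d -[X in (_ <= X)%N -> _]mul1n leq_pmul2r //.
by rewrite leqNgt (leq_trans _ (Lmono (leq_trans (_ : 1 <= 120)%N e_ge))) ?expn1.
Qed.

(** Otherwise all traces on D^2 are 0, 2 or -2. Choose noncommuting g, g' in D without a common
    eigenline. By [trace_fibre] the map x |-> (tr x, tr xg, tr xg') has fibres of size at most 2 on
    D and takes at most 27 values, contrary to |D| >= 64. *)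
Let escape : exists2 g, g \in (D ^+ 2)%g & regular g.
Proof.
apply/exists_inP; apply: contraT => /exists_inPn reg2.
have [u0 u00] : exists u : 'cV[F]_2, u != 0.
  exists (delta_mx 0 0).
  by apply/eqP => /matrixP/(_ 0 0); rewrite !mxE /= => /eqP; rewrite oner_eq0.
pose B v (v0 : v != 0) := Group (line_stab_group_set rhoG v0).
have Bp v (v0 : v != 0) : B v v0 \proper G by apply: line_stab_proper.
have [g [gD gB _ _]] := avoid (Bp _ u00) (Bp _ u00) (Bp _ u00).
have gG : g \in G by apply: subsetP DG _ gD.
have ng : nonscalar rho g.
  move=> a; apply: contraNneq gB => ea; apply/setIdP; split=> //.
  by rewrite ea mul_scalar_mx crossZr crossvv mulr0.
have [v1 [v2 [v10 v20 hv]]] := two_eigenlines ng.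
have [g' [g'D g'1 g'2 g'C]] := avoid (Bp _ v10) (Bp _ v20) (cent_proper rhoG ng).
have g'G : g' \in G by apply: subsetP DG _ g'D.
pose T : {set F} := [set x in [:: 0; 2; -2]].
have T3 : (#|T| <= 3)%N by rewrite cardsE card_size.
have inT x : x \in (D ^+ 2)%g -> tr x \in T by move/reg2; rewrite inE negbK.
suff h : (d <= #|setX T (setX T T)| * 2)%N.
  have h9 : (#|setX T (setX T T)| <= 3 * (3 * 3))%N by rewrite !cardsX !leq_mul.
  have h64 : (64 <= d)%N by apply: leq_trans (_ : 64 <= 2 ^ 6)%N _ => //; apply: leq_trans (leq_trans (Lge 6) (Lmono (leq_trans _ e_ge))) largeD.
  by have := leq_trans (leq_trans h64 h) (leq_mul h9 (leqnn 2)).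
apply: (card_fibers_le (f := fun x => (tr x, (tr (x * g)%g, tr (x * g')%g)))).
  move=> x xD; rewrite !in_setX !inT //; first by apply: (powM (i := 1) (j := 1)); apply: mem1.
    by apply: (powM (i := 1) (j := 1)); apply: mem1.
  by rewrite -[x]mulg1; apply: (powM (i := 1) (j := 1)); apply: mem1.
move=> t _; rewrite leqNgt; apply/negP => /card_gt2P[x [x1 [x2 [[]]]]].
case/setIdP=> xD /eqP <-; case/setIdP=> x1D /eqP e1; case/setIdP=> x2D /eqP e2 [n01 n12 n20].
move: e1 e2 => [a1 b1 c1] [a2 b2 c2].
have xG := subsetP DG _ xD.
pose D_ y := rho (y * x^-1)%g - 1%:M.
have dE y : 1%:M + D_ y = rho (y * x^-1)%g by rewrite addrC subrK.
have dS y : y \in D -> \det (1%:M + D_ y) = 1.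
  by move=> yD; rewrite dE; apply: (det_SL2 rhoG); rewrite groupM ?groupV // (subsetP DG).
have dn y : x != y -> D_ y != 0.
  apply: contra; rewrite subr_eq0 -(rho1 rhoG) => /eqP/(rho_inj rhoG) eyx.
  by rewrite -(mulgKV x y) eyx mul1g.
have dd y z : tr (y * z)%g = tr (x * z)%g -> \tr (D_ y *m rho (x * z)%g) = 0.
  by move=> eyz; rewrite mulmxBl mul1mx -(rhoM rhoG) mulgA mulgKV raddfB /= eyz subrr.
have dn12 : D_ x1 != D_ x2.
  by apply: contra n12 => /eqP/addIr/(rho_inj rhoG)/mulIg ->.
have n02 : x != x2 by rewrite eq_sym.
case: (@trace_fibre _ (D_ x1) (D_ x2) (rho (x * 1)%g) (rho (x * g)%g) (rho (x * g')%g)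
   (dn _ n01) (dn _ n02) dn12 (dS _ x1D) (dS _ x2D)) => [||[v v0 [cw cx cy]]|dep].
- by split; apply: dd; rewrite ?mulg1.
- by split; apply: dd; rewrite ?mulg1.
- have xB : x \in B v v0 by apply/setIdP; rewrite mulg1 in cw; rewrite xG cw.
  have inB k : k \in G -> cross v (rho (x * k)%g *m v) = 0 -> k \in B v v0.
    move=> kG ck; rewrite -(groupMl _ xB); apply/setIdP; split; first exact: groupM.
    exact/eqP.
  have /setIdP[_ /eqP eg] := inB _ gG cx; have /setIdP[_ /eqP eg'] := inB _ g'G cy.
  case: (hv v v0 eg) => c.
    by case/negP: g'1; apply/setIdP; split=> //; apply/eqP; apply: eigenline_eq c eg'.
  by case/negP: g'2; apply/setIdP; split=> //; apply/eqP; apply: eigenline_eq c eg'.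
have xu : rho x \in unitmx by rewrite unitmxE (det_SL2 rhoG) // unitr1.
have [||a [b]] := dep.
- by rewrite mulg1; apply: contraTneq xu => ->; rewrite unitmxE det0 unitr0.
- move=> a; rewrite mulg1 (rhoM rhoG); apply: contra (ng a) => /eqP eg; apply/eqP.
  by rewrite -[rho g](mulKmx xu) eg -scalemxAr mulVmx // scalemx1.
rewrite mulg1 !(rhoM rhoG) => /(congr1 (mulmx (invmx (rho x)))).
rewrite mulmxDr -!scalemxAr !mulKmx // mulVmx // => eg'.
case/negP: g'C; suff: g' \in 'C_G[g]%g by [].
apply/(sl2_centP rhoG); split=> //.
by rewrite eg' mulmxDr mulmxDl -!scalemxAr -!scalemxAl mulmx1 mul1mx.
Qed.

(** For this part X of D^6, X^-1 X lies in D^12, of size at most L^39 d. If g in D lies outside a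
    Borel subgroup, X g X lies in D^13, so X meets that subgroup in b elements with b^2 <= 4 L^42 d
    <= L^44 d. *)
Let class_card t : t != 0 -> t ^+ 2 != 4 ->
  (#|[set x in D ^+ 6 | tr x == t]%g| ^ 3 <= L ^ 100 * d ^ 2)%N.
Proof.
move=> t0 t4; set X := [set x in _ | _].
have XD : X \subset (D ^+ 6)%g by apply/subsetP => x /setIdP[].
have XG : X \subset G := subset_trans XD (powG 6).
have tX : {in X, forall x, tr x = t} by move=> x /setIdP[_ /eqP].
have nX : {in X, forall x, nonscalar rho x}.
  move=> x xX; apply: (regular_nonscalar rhoG); first exact: subsetP XG _ xX.
  by rewrite tX.
pose b := \max_(v : 'cV[F]_2 | v != 0) #|X :&: line_stab G rho v|.
have bX v : v != 0 -> (#|X :&: line_stab G rho v| <= b)%N.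
  by move=> v0; exact: (@leq_bigmax_cond _ (fun v => v != 0) (fun v => #|X :&: line_stab G rho v|)).
apply: (class_arith L2 d0 (class_bound rhoG t0 XG tX nX bX)); last first.
  apply: leq_trans (powD 12); apply: subset_leq_card; rewrite -[12%N]/(6 + 6)%N expgD.
  by apply: mulgSS => //; rewrite -(sym_expg 6 DV) invSg.
apply: (big_ind (fun b => b ^ 2 <= L ^ 44 * d)%N) => // [b1 b2 h1 h2|v v0].
  by rewrite /maxn; case: ifP.
pose B := Group (line_stab_group_set rhoG v0).
have Bp : B \proper G by apply: line_stab_proper.
have [g [gD gB _ _]] := avoid Bp Bp Bp.
have gG : g \in G by apply: subsetP DG _ gD.
set Y := X :&: _; have YX : Y \subset X := subsetIl _ _.
have tY : {in Y, forall x, tr x = t} by move=> x /(subsetP YX)/tX.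
apply: leq_trans (card_class_stab rhoG v0 gG gB (subsetIr _ _) tY) _.
have YD := subset_trans YX XD.
apply: leq_trans (_ : 4 * #|(D ^+ 13)%g| <= _)%N.
  rewrite leq_mul2l /=; apply: subset_leq_card; rewrite -[13%N]/(6 + 1 + 6)%N !expgD expg1.
  by do 2![apply: mulgSS => //]; rewrite sub1set.
apply: leq_trans (leq_mul (leqnn 4) (powD 13)) _.
rewrite mulnA leq_mul2r; apply/orP; right.
by rewrite -[44%N]/(2 + (3 * 13 + 3))%N [(L ^ (2 + _))%N]expnD leq_mul2r (Lge 2) orbT.
Qed.

(* Orbit-stabiliser for the conjugation action of D on g. *)
Let centraliser_big g : g \in (D ^+ 4)%g -> regular g ->
  (d <= L ^ 100 * #|(D ^+ 2 :&: 'C_G[g])%g| ^ 3)%N.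
Proof.
move=> gD /regular_tr[t0 t4]; set m := #|_|; have gG := mem_pow gD.
have h : (d <= #|[set x in D ^+ 6 | tr x == tr g]%g| * m)%N.
  apply: (card_fibers_le (f := fun x => (x * g * x^-1)%g)) => [x xD|y _].
    apply/setIdP; rewrite (tr_conj rhoG) eqxx; split=> //.
    apply: (powM (i := 5) (j := 1)); last exact/powV/mem1.
    by apply: (powM (i := 1) (j := 4)); first exact: mem1.
  have [->|[x0 /setIdP[x0D /eqP e0]]] := set_0Vmem [set x in D | (x * g * x^-1)%g == y].
    by rewrite cards0.
  rewrite -(card_imset _ (mulgI (x0^-1)%g)); apply: subset_leq_card.
  apply/subsetP => _ /imsetP[x /setIdP[xD /eqP e1] ->]; apply/setIP; split.
    by apply: (powM (i := 1) (j := 1)); [apply: powV|]; apply: mem1.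
  apply/setIP; split; first by rewrite groupM ?groupV // (subsetP DG).
  apply/cent1P; rewrite /commute mulgA.
  apply: (mulgI x0); apply: (mulIg x^-1%g); by rewrite !mulgA mulgV mul1g mulgK e1 e0.
have hN := class_card t0 t4; set N := #|_| in h hN.
(* From d <= N m and N^3 <= L^100 d^2 follows d^3 <= L^100 d^2 m^3. *)
rewrite -(@leq_pmul2l (d ^ 2)) ?expn_gt0 ?d0 // -expnSr.
apply: leq_trans (_ : (N * m) ^ 3 <= _)%N; first by rewrite leq_exp2r.
by rewrite expnMn mulnA [(d ^ 2 * _)%N]mulnC leq_mul2r hN orbT.
Qed.

Let large j k : (k <= 2 ^ j -> 100 + j < 120 -> d <= L ^ 100 * k -> False)%N.
Proof.
move=> kj j20 h; have : (d <= L ^ 119)%N.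
  apply: leq_trans h _; apply: leq_trans (_ : L ^ (100 + j) <= _)%N; last exact: Lmono.
  by rewrite expnD leq_mul2l (leq_trans kj) ?orbT.
apply/negP; rewrite -ltnNge; apply: leq_trans largeD.
by apply: leq_trans (Lmono e_ge); rewrite ltn_exp2l.
Qed.

(** The torus has at most 6 elements that are not regular. With at most 6 regular ones in D^2, the
    total of 12 would contradict the size of D, as 12^3 <= 2^11. Hence at least half are regular,
    which costs 2^3 <= L^3. *)
Let card_regular_cent g : g \in (D ^+ 4)%g -> regular g ->
  (7 <= #|[set a in (D ^+ 2 :&: 'C_G[g])%g | regular a]| /\
   d <= L ^ 103 * #|[set a in (D ^+ 2 :&: 'C_G[g])%g | regular a]| ^ 3)%N.
Proof.
move=> gD rg; have h := centraliser_big gD rg; have gG := mem_pow gD.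
set A := (_ :&: _) in h *; set c := #|_|.
have hA : (#|A| <= c + 6)%N.
  rewrite -(cardsID [set a | regular a] A); apply: leq_add.
    by apply: subset_leq_card; apply/subsetP => a /setIP[aA]; rewrite inE => ra; apply/setIdP.
  apply: leq_trans (card_cent_nonregular rhoG char_neq2 gG (regular_tr rg).2).
  apply: subset_leq_card; apply/subsetP => a /setDP[/setIP[_ aC]]; rewrite inE => ra.
  exact/setIdP.
have c7 : (7 <= c)%N.
  rewrite ltnNge; apply/negP => c6; apply: (@large 11 (12 ^ 3)) => //.
  apply: leq_trans h _; rewrite leq_mul2l leq_exp2r //; apply/orP; right.
  by apply: leq_trans hA _; rewrite -[12%N]/(6 + 6)%N leq_add2r.
split=> //; apply: leq_trans h _; rewrite -[103%N]/(100 + 3)%N expnD -mulnA leq_mul2l -expnMn.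
apply/orP; right; rewrite leq_exp2r //; apply: leq_trans hA _.
apply: leq_trans (_ : 2 * c <= _)%N; last by rewrite leq_mul2r L2 orbT.
by rewrite mul2n -addnn leq_add2l ltnW.
Qed.

Let cent_conj g h x : x \in G -> g \in 'C_G[h]%g -> (x * g * x^-1)%g \in 'C_G[x * h * x^-1]%g.
Proof.
move=> xG /setIP[gG /cent1P egh]; apply/setIP; split; first by rewrite groupM ?groupV // groupM.
apply/cent1P; rewrite /commute !mulgA !mulgKV -!(mulgA x); congr (x * _)%g.
by rewrite egh.
Qed.

(** Induction on the length of x as a word in D. Conjugation by one letter takes a regular element
    of D^2 into D^4, and [card_regular_cent] replaces it by a regular element of D^2 in the same
    torus. *)
Let spread g0 : g0 \in (D ^+ 2)%g -> regular g0 -> forall x, x \in G ->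
  exists g, [/\ g \in (D ^+ 2)%g, regular g & g \in 'C_G[x * g0 * x^-1]%g].
Proof.
move=> g0D rg0 x xG; have xD : x \in <<D>>%g by rewrite generates.
have [n Dn] := gen_expgs D; have D1D : (1 |: D = D)%g by apply/setUidPr; rewrite sub1set.
move: xD; rewrite Dn D1D {Dn xG}; elim: n x => [|n IH] x.
  rewrite expg0 => /set1P ->; exists g0; split=> //; rewrite mul1g invg1 mulg1.
  by apply/setIP; split; [exact: mem_pow g0D | apply/cent1P].
rewrite expgS => /mulsgP[y z yD zD ->]; have [g [gD rg gC]] := IH z zD.
have yG : y \in G by apply: subsetP DG _ yD.
have yg4 : (y * g * y^-1)%g \in (D ^+ 4)%g.
  apply: (powM (i := 3) (j := 1)); last exact/powV/mem1.
  by apply: (powM (i := 1) (j := 2)); first exact: mem1.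
have ryg : regular (y * g * y^-1)%g by rewrite (regular_conj rhoG).
have [c7 _] := card_regular_cent yg4 ryg.
have /card_gt0P[a /setIdP[/setIP[aD aC] ra]] := leq_trans (isT : 0 < 7)%N c7.
exists a; split=> //.
have zG := mem_pow zD; have g0G := mem_pow g0D.
have -> : (y * z * g0 * (y * z)^-1 = y * (z * g0 * z^-1) * y^-1)%g by rewrite invMg !mulgA.
have wG : (y * (z * g0 * z^-1) * y^-1)%g \in G.
  by rewrite groupM ?groupV // groupM // groupM ?groupV // groupM.
have rw : regular (y * (z * g0 * z^-1) * y^-1)%g by rewrite !(regular_conj rhoG).
rewrite (cent_eq rhoG wG (regular_tr rw).2 (mem_pow yg4) (regular_tr ryg).2) //.
exact: cent_conj.
Qed.

Let card_G_ge : (q ^ 3 <= 2 * #|G|)%N.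
Proof.
rewrite (card_SL2 rhoG); have := card_finNzRing_gt1 F; move: q => k; clear.
by move=> k1; rewrite mulnCA expnS leq_mul2l; apply/orP; right; rewrite -mulnn; nia.
Qed.

(** Count the pairs of x in G and a regular a in D^2 centralising x g0 x^-1. Every x has at least m
    partners, where d <= L^103 m^3, and every a has at most 4q, so q^2 m <= L^12 d. Cubing gives q^6
    <= L^139 d^2, against L^240 d^2 <= q^6. *)
Lemma product_theorem : False.
Proof.
have [g0 g0D rg0] := escape; have g0G := mem_pow g0D.
pose C x := [set a in (D ^+ 2 :&: 'C_G[x * g0 * x^-1])%g | regular a].
have hC x : x \in G -> (d <= L ^ 103 * #|C x| ^ 3)%N.
  move=> xG; have [g [gD rg gC]] := spread g0D rg0 xG.
  have g4 : g \in (D ^+ 4)%g by apply: subsetP (sub_expg D1 _) _ gD.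
  have xgG : (x * g0 * x^-1)%g \in G by rewrite groupM ?groupV // groupM.
  have rxg : regular (x * g0 * x^-1)%g by rewrite (regular_conj rhoG).
  rewrite /C (cent_eq rhoG xgG (regular_tr rxg).2 (mem_pow g4) (regular_tr rg).2 gC).
  exact: (card_regular_cent g4 rg).2.
have exm : exists m, (d <= L ^ 103 * m ^ 3)%N by exists #|C 1%g|; apply: hC; apply: group1.
(* The least such m is an integer cube root and a lower bound for every [C x]. *)
case: (ex_minnP exm) => m hm minm.
pose P := [set z in setX G (D ^+ 2)%g | z.2 \in C z.1].
have PG : (#|G| * m <= 1 * #|P|)%N.
  apply: (@card_fibers_ge _ _ (fun z : gT * gT => z.1) P G 1 m) => x xG; rewrite mul1n.
  apply: leq_trans (minm _ (hC x xG)) _.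
  rewrite -(card_imset _ (f := fun a => (x, a))) => [|? ? []] //.
  apply: subset_leq_card; apply/subsetP => _ /imsetP[a aC ->].
  apply/setIdP; split=> //; apply/setIdP; split=> //; rewrite in_setX xG.
  by case/setIdP: aC => /setIP[].
have PD : (#|P| <= #|(D ^+ 2)%g| * (1 * 2 * (2 * q)))%N.
  apply: (@card_fibers_le _ _ (fun z : gT * gT => z.2) P (D ^+ 2)%g).
    by move=> [u v] /setIdP[/setXP[]].
  move=> a aD.
  have aG := mem_pow aD.
  have [ra|nra] := boolP (regular a); last first.
    rewrite (_ : [set _ in _ | _] = set0) ?cards0 //; apply/setP=> z; rewrite [RHS]inE.
    by apply/negP => /setIdP[/setIdP[_ /setIdP[_ rz]] /eqP za]; case/negP: nra; rewrite -za.
  apply: leq_trans (_ : #|[set x in G | a \in C x]| <= _)%N.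
    rewrite -(@card_in_imset _ _ (fun s : gT * gT => s.1)) => [|[u v] [u' v']]; last first.
      by case/setIdP=> _ /eqP /= -> /setIdP[_ /eqP /= ->] ->.
    apply: subset_leq_card; apply/subsetP => _ /imsetP[[u v] /setIdP[/setIdP[/setXP[uG _] vC] /eqP va] ->].
    by apply/setIdP; split=> //; rewrite -va.
  have t4 := (regular_tr ra).2; have g04 := (regular_tr rg0).2.
  (* If a centralises x g0 x^-1, then x^-1 a x lies in the torus of g0 and has the trace of a, which
     leaves two values; the x with a given value lie in one coset of the centraliser of a. *)
  pose Y := [set z in 'C_G[g0]%g | tr z \in [set tr a]].
  have Y2 : (#|Y| <= 1 * 2)%N by have := card_cent_traces rhoG char_neq2 [set tr a] g0G g04; rewrite cards1.
  apply: leq_trans (_ : #|Y| * (2 * q) <= _)%N; last by rewrite leq_mul2r Y2 orbT.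
  apply: (card_fibers_le (f := fun x => (x^-1 * a * x)%g)) => [x|y _].
    case/setIdP=> xG /setIdP[/setIP[_ aC] _]; apply/setIdP; split; last first.
      by rewrite inE -{2}[x]invgK (tr_conj rhoG).
    have := cent_conj (groupVr xG) aC.
    by rewrite invgK !mulgA mulVg mul1g mulgKV.
  have [->|[x0 /setIdP[/setIdP[x0G _] /eqP e0]]] :=
    set_0Vmem [set x in [set x in G | a \in C x] | (x^-1 * a * x)%g == y].
    by rewrite cards0.
  apply: leq_trans (card_cent rhoG char_neq2 aG t4).
  rewrite -[X in (X <= _)%N](card_imset _ (mulIg (x0^-1)%g)); apply: subset_leq_card.
  apply/subsetP => _ /imsetP[x /setIdP[/setIdP[xG _] /eqP e1] ->]; apply/setIP; split.
    by rewrite groupM ?groupV.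
  apply/cent1P; rewrite /commute; apply: (mulgI (x^-1)%g); apply: (mulIg x0).
  by rewrite !mulgA mulVg mul1g mulgKV e1 -e0.
have q0 : (0 < q)%N by apply/card_gt0P; exists 0.
have h1 : (q ^ 2 * m <= L ^ 12 * d)%N.
  have h : (q ^ 3 * m <= 2 * (L ^ (3 * 2 + 3) * d * (1 * 2 * (2 * q))))%N.
    apply: leq_trans (leq_mul card_G_ge (leqnn m)) _; rewrite -mulnA leq_mul2l /=.
    apply: leq_trans PG _; rewrite mul1n; apply: leq_trans PD _.
    by rewrite leq_mul2r powD orbT.
  rewrite -(leq_pmul2l q0) mulnA -expnS; apply: leq_trans h _.
  rewrite -[12%N]/(3 * 2 + 3 + 3)%N [(L ^ (3 * 2 + 3 + 3))%N]expnD.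
  move: (L ^ (3 * 2 + 3))%N (Lge 3) => A L3; move: (d) => d'.
  apply: leq_trans (_ : q * (A * 2 ^ 3 * d') <= _)%N; last by rewrite !leq_mul.
  by apply: eq_leq; rewrite -[(2 ^ 3)%N]/8%N; ring.
have h2 : (q ^ 6 * d <= L ^ 139 * d ^ 3)%N.
  apply: leq_trans (_ : q ^ 6 * (L ^ 103 * m ^ 3) <= _)%N; first by rewrite leq_mul2l hm orbT.
  have h : ((q ^ 2 * m) ^ 3 <= (L ^ 12 * d) ^ 3)%N by rewrite leq_exp2r.
  rewrite (expnMn _ m) (expnMn _ d) -!expnM in h.
  by rewrite mulnCA -[139%N]/(103 + 12 * 3)%N expnD -mulnA leq_mul2l h orbT.
have h3 : (L ^ (e * 2) * d ^ 2 <= q ^ 6)%N.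
  have h : ((L ^ e * d) ^ 2 <= (q ^ 3) ^ 2)%N by rewrite leq_exp2r.
  by rewrite expnMn -!expnM in h.
have : (L ^ 240 * d ^ 2 * d <= L ^ 139 * d ^ 2 * d)%N.
  apply: leq_trans (_ : q ^ 6 * d <= _)%N; last by rewrite -mulnA -expnSr.
  rewrite leq_mul2r; apply/orP; right; apply: leq_trans h3.
  by rewrite leq_mul2r Lmono ?orbT // -[240%N]/(120 * 2)%N leq_mul2r e_ge orbT.
by rewrite !leq_pmul2r ?expn_gt0 ?d0 // leq_exp2l.
Qed.

End ProductTheorem.

(** * Flattening of the energy *)

Section Flattening.
Local Open Scope nat_scope.
Variables (F : finFieldType) (gT : finGroupType) (G : {group gT}) (rho : gT -> 'M[F]_2).

(* 32 is the loss in [bsg_pow]; [product_theorem] needs the exponent 120, and passing from S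
   to D costs five more powers of L = K ^ 32. *)
Lemma energy_flattening (K : nat) (S : {set gT}) :
  sl2_model G rho -> (2 != 0 :> F)%R -> 1 < K -> S \subset G ->
  (forall (H : {group gT}) g, H \proper G -> g \in G ->
     K ^ (32 * 125) * #|S :&: (g *: H)%g| <= #|S|) ->
  K ^ (32 * 125) <= #|S| -> K ^ (32 * 125) * #|S| <= #|F| ^ 3 ->
  K * energy S < #|S| ^ 3.
Proof.
move=> rhoG n2 K1 SG conS largeS smallS; rewrite ltnNge; apply/negP => hE.
have K0 : 0 < K by apply: ltnW.
have S0 : 0 < #|S| by apply: leq_trans largeS; rewrite expn_gt0 K0.
have [A [AS A1 A2]] := bsg_pow K1 S0 hE.
have A0 : 0 < #|A| by move: (leq_trans S0 A1); rewrite muln_gt0 => /andP[].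
have [D [D1 DV AD DG [powD conD]]] := popular_quotients A0 A2.
move: AD powD conD conS largeS smallS; rewrite expnM.
have KL : K ^ 4 <= K ^ 32 by rewrite leq_exp2l.
have : 1 < K ^ 32 by apply: leq_trans KL; rewrite (leq_trans K1) // -{1}[K]expn1 leq_exp2l.
move: (K ^ 32) KL A2 => L KL A2 L1 AD powD conD conS largeS smallS.
have L0 : 0 < L by apply: ltnW.
have L2 : 2 * L <= L ^ 2 by rewrite -mulnn leq_mul2r L1 orbT.
have L3 : 2 * L ^ 2 <= L ^ 3 by rewrite [L ^ 3]expnS leq_mul2r L1 orbT.
have {}AD : #|A| <= L ^ 2 * #|D| by apply: leq_trans AD _; rewrite leq_mul2r L2 orbT.
have SD : #|S| <= L ^ 3 * #|D|.
  by apply: leq_trans A1 _; rewrite [L ^ 3]expnS -mulnA; apply: leq_mul.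
(* A coset g H with g outside G misses S, so the hypothesis on cosets extends to all g. *)
have subG (H : {set gT}) g : H \subset G -> g \notin G -> #|S :&: (g *: H)%g| = 0.
  move=> HG gG; apply/eqP; rewrite cards_eq0 -subset0; apply/subsetP=> x.
  case/setIP=> xS; rewrite mem_lcoset => /(subsetP HG) gx; case/negP: gG.
  by rewrite -groupV -(groupMr _ (subsetP SG _ xS)).
apply: (@product_theorem F gT G rho rhoG n2 D L 120) => //.
- exact: DG (subset_trans AS SG).
- move=> j; apply: leq_trans (powD j) _; rewrite expnD expnM -mulnA; apply: leq_mul.
    by case: j => // j; rewrite leq_exp2r.
  by rewrite [L ^ 3]expnS -mulnA leq_mul2l AD orbT.
(* This m bounds S, and hence A, on every left coset of H. The exponent 125 drops by 3 through |S|
   <= L^3 |D| and by 2 through the loss 2 L <= L^2. *)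
- move=> H HG; pose m := #|S| %/ L ^ 125.
  have L125 : 0 < L ^ 125 by rewrite expn_gt0 L0.
  have hm c : #|A :&: (c *: H)%g| <= m.
    apply: leq_trans (subset_leq_card (setSI _ AS)) _.
    have [cG|cG] := boolP (c \in G); last by rewrite subG // (proper_sub HG).
    by rewrite leq_divRL // mulnC conS.
  have := conD H 1%g m hm; rewrite lcoset1 => h.
  have hmS : L ^ 122 * m <= #|D|.
    rewrite -(@leq_pmul2l (L ^ 3)) ?expn_gt0 ?L0 // mulnA -expnD; apply: leq_trans SD.
    by rewrite mulnC leq_trunc_div.
  apply: leq_trans hmS; rewrite -[122]/(120 + 2) expnD -mulnA leq_mul2l; apply/orP; right.
  by apply: leq_trans h _; rewrite leq_mul2r L2 orbT.
- rewrite -(@leq_pmul2l (L ^ 3)) ?expn_gt0 ?L0 // -expnD; apply: leq_trans SD.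
  by apply: leq_trans largeS; rewrite leq_exp2l.
- apply: leq_trans smallS; rewrite -[125]/(120 + 5) expnD -mulnA leq_mul2l; apply/orP; right.
  have := powD 1; rewrite expg1 expn1 => h; apply: leq_trans h _.
  apply: leq_trans (_ : L ^ 3 * (L ^ 2 * #|S|) <= _); last by rewrite mulnA -expnD.
  apply: leq_mul; rewrite // ?expn1 //; apply: leq_mul; last exact: subset_leq_card.
  by rewrite -{1}[L]expn1 leq_exp2l.
Qed.

End Flattening.

(** * Counting incidences *)

Section CauchySchwarz.
Local Open Scope ring_scope.
(** Lagrange's identity: the difference of the two sides is half the sum of the squares (a_i b_j -
    a_j b_i)^2. *)
Lemma sum_mul_sqr_le (R : realFieldType) (I : finType) (P : {pred I}) (a b : I -> R) :
  (\sum_(i in P) a i * b i) ^+ 2 <= (\sum_(i in P) a i ^+ 2) * (\sum_(i in P) b i ^+ 2).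
Proof.
set A := \sum_(i in P) a i ^+ 2; set B := \sum_(i in P) b i ^+ 2; set C := \sum_(i in P) _.
have : 0 <= \sum_(i in P) \sum_(j in P) (a i * b j - a j * b i) ^+ 2.
  by apply: sumr_ge0 => i _; apply: sumr_ge0 => j _; apply: sqr_ge0.
have -> : \sum_(i in P) \sum_(j in P) (a i * b j - a j * b i) ^+ 2 = A * B + B * A - 2 * (C * C).
  rewrite [A * B]big_distrlr [B * A]big_distrlr [C * C]big_distrlr /= big_distrr /=.
  rewrite -big_split -sumrB /=; apply: eq_bigr => i _.
  rewrite big_distrr -big_split -sumrB /=; apply: eq_bigr => j _; ring.
by rewrite -expr2; lra.
Qed.
End CauchySchwarz.

(** * Pairs with a given determinant *)

Section Determinants.
Local Open Scope ring_scope.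
Variables (R : realFieldType) (F : finFieldType).
Local Notation q := #|F|.
Implicit Types (u v x : 'cV[F]_2).

Lemma cross_bij u v : cross u v != 0 -> bijective (fun x => (cross x u, cross x v)).
Proof.
move=> uv; apply: inj_card_bij; last by rewrite card_prod card_mx mulnn.
move=> x y [e1 e2]; have sw a b : cross a b = - cross b a by rewrite /cross; ring.
have e3 : cross u x = cross u y by rewrite sw e1 -sw.
by rewrite (cross_decomp x uv) (cross_decomp y uv) e2 e3.
Qed.

Lemma sum_cross_sqr (c : F -> R) u : u != 0 ->
  \sum_x c (cross x u) ^+ 2 = q%:R * \sum_t c t ^+ 2.
Proof.
case/cross_ex => v uv; have uv0 : cross u v != 0 by rewrite uv oner_eq0.
have <- : \sum_(z : F * F) c z.1 ^+ 2 = \sum_x c (cross x u) ^+ 2.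
  by rewrite (reindex _ (onW_bij _ (cross_bij uv0))).
rewrite -(pair_bigA _ (fun s t => c s ^+ 2)) /=.
by under eq_bigr do rewrite sumr_const; rewrite sumrMnl mulr_natl.
Qed.

Lemma sum_cross_mul (c : F -> R) u v : cross u v != 0 ->
  \sum_x c (cross x u) * c (cross x v) = (\sum_t c t) ^+ 2.
Proof.
move=> uv.
have <- : \sum_(z : F * F) c z.1 * c z.2 = \sum_x c (cross x u) * c (cross x v).
  by rewrite (reindex _ (onW_bij _ (cross_bij uv))).
by rewrite -(pair_bigA _ (fun s t => c s * c t)) /= expr2 big_distrlr.
Qed.

Variable E : {set 'cV[F]_2}.
Hypothesis E0 : 0 \notin E.

Definition det_count (t : F) : nat := #|[set z in setX E E | cross z.1 z.2 == t]|.

Let En0 u : u \in E -> u != 0.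
Proof. by apply: contraTneq => ->. Qed.

(** On expanding the square, a pair of independent vectors contributes the square of the sum of c,
    which is 0. Only proportional pairs remain, each contributing at most q times the sum of c^2. *)
Lemma sum_dual_sqr_le (c : F -> R) : \sum_t c t = 0 ->
  \sum_x (\sum_(u in E) c (cross x u)) ^+ 2 <=
    (det_count 0)%:R * (q%:R * \sum_t c t ^+ 2).
Proof.
move=> c0; set Q := \sum_t c t ^+ 2.
have -> : \sum_x (\sum_(u in E) c (cross x u)) ^+ 2 =
    \sum_(u in E) \sum_(v in E) \sum_x c (cross x u) * c (cross x v).
  under eq_bigr do rewrite expr2 big_distrlr /=.
  by rewrite exchange_big; apply: eq_bigr => u _; rewrite exchange_big.
have -> : (det_count 0)%:R * (q%:R * Q) =
    \sum_(u in E) \sum_(v in E) (if cross u v == 0 then q%:R * Q else 0).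
  rewrite pair_big /= -big_mkcondr /= sumr_const mulr_natl; congr (_ *+ _).
  by rewrite /det_count; apply: eq_card => -[u v]; rewrite !inE.
apply: ler_sum => u uE; apply: ler_sum => v vE.
case: eqVneq => uv; last by rewrite sum_cross_mul // c0 expr0n.
have : 0 <= \sum_x (c (cross x u) - c (cross x v)) ^+ 2.
  by apply: sumr_ge0 => x _; apply: sqr_ge0.
have -> : \sum_x (c (cross x u) - c (cross x v)) ^+ 2 =
   \sum_x c (cross x u) ^+ 2 + \sum_x c (cross x v) ^+ 2 - 2 * \sum_x c (cross x u) * c (cross x v).
  by rewrite big_distrr -big_split -sumrB /=; apply: eq_bigr => x _; ring.
by rewrite !sum_cross_sqr ?En0 // -/Q; lra.
Qed.

Lemma sum_det_count : \sum_t det_count t = (#|E| ^ 2)%N.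
Proof. by rewrite (sum_card_fibers (Y := predT)) // cardsX mulnn. Qed.

(** Let c be the deviation of [det_count] from its mean and Q the sum of c^2; Q is also the sum of
    c(det(u, v)) over pairs in E. Cauchy-Schwarz in u, extended to all vectors, and the dual bound
    give Q^2 <= q |E| [det_count 0] Q. *)
Lemma sum_det_count_sqr :
  \sum_t (det_count t)%:R ^+ 2 <=
    (#|E|%:R ^+ 4) / q%:R + q%:R * #|E|%:R * (det_count 0)%:R :> R.
Proof.
have q0 : q%:R != 0 :> R by rewrite pnatr_eq0 -lt0n; apply/card_gt0P; exists 0.
have q_gt0 : 0 < q%:R :> R by rewrite lt0r q0 ler0n.
pose a : R := #|E|%:R ^+ 2 / q%:R; pose c t : R := (det_count t)%:R - a.
have sumT (b : R) : \sum_(t : F) b = q%:R * b by rewrite sumr_const mulr_natl.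
have sum_nu : \sum_t (det_count t)%:R = #|E|%:R ^+ 2 :> R.
  by rewrite -natr_sum sum_det_count natrX.
have c0 : \sum_t c t = 0.
  by rewrite sumrB sum_nu sumT /a mulrC divfK // subrr.
set Q := \sum_t c t ^+ 2.
have e1 : \sum_t (det_count t)%:R ^+ 2 = #|E|%:R ^+ 4 / q%:R + Q.
  have -> : Q = \sum_t (det_count t)%:R ^+ 2 - 2 * a * (\sum_t (det_count t)%:R) + q%:R * a ^+ 2.
    rewrite -sumT big_distrr -sumrB -big_split /=; apply: eq_bigr => t _.
    by rewrite /c; ring.
  by rewrite sum_nu /a; field.
rewrite e1 lerD2l.
have e2 : Q = \sum_(u in E) \sum_(v in E) c (cross u v).
  transitivity (\sum_t c t * (det_count t)%:R).
    have -> : \sum_t c t * (det_count t)%:R = Q + a * \sum_t c t.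
      by rewrite big_distrr -big_split /=; apply: eq_bigr => t _; rewrite /c; ring.
    by rewrite c0 mulr0 addr0.
  rewrite pair_big /= (partition_big (fun z => cross z.1 z.2) predT) //=.
  apply: eq_bigr => t _; rewrite (eq_bigr (fun=> c t)) => [|z /andP[_ /eqP ->]] //.
  rewrite sumr_const -[RHS]mulr_natr; congr (_ * _%:R).
  by apply: eq_card => -[u v]; rewrite !inE.
have Q0 : 0 <= Q by apply: sumr_ge0 => t _; apply: sqr_ge0.
have e3 : Q ^+ 2 <= #|E|%:R * ((det_count 0)%:R * (q%:R * Q)).
  rewrite {1}e2 -[X in X ^+ 2](eq_bigr _ (fun u _ => mul1r _)).
  apply: le_trans (sum_mul_sqr_le _ _ _) _.
  rewrite sumr_const expr1n; apply: ler_wpM2l; first exact: ler0n.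
  apply: le_trans (sum_dual_sqr_le c0).
  rewrite [leRHS](bigID (mem E)) /= lerDl; apply: sumr_ge0 => x _; exact: sqr_ge0.
have [->|Qn0] := eqVneq Q 0; first by rewrite !mulr_ge0 ?ler0n.
have Qp : 0 < Q by rewrite lt0r Qn0.
rewrite -(ler_pM2r Qp) -expr2; apply: le_trans e3 _; rewrite le_eqVlt; apply/orP; left.
by apply/eqP; ring.
Qed.

End Determinants.

(** * Return counts and the size of the image *)

Section Image.
Local Open Scope ring_scope.
Variables (F : finFieldType) (gT : finGroupType) (G : {group gT}) (rho : gT -> 'M[F]_2).
Hypothesis rhoG : sl2_model G rho.
Local Notation q := #|F|.
Implicit Types (u v x : 'cV[F]_2) (g : gT).
Variable E : {set 'cV[F]_2}.
Hypothesis E0 : 0 \notin E.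
Local Notation D := (det_count E 0).

Definition return_count g : nat := #|[set u in E | rho g *m u \in E]|.

Let En0 u : u \in E -> u != 0.
Proof. by apply: contraTneq => ->. Qed.

Lemma card_to_E u : u \in E -> #|[set g in G | rho g *m u \in E]| = (q * #|E|)%N.
Proof.
move=> uE; have XE : {in [set g in G | rho g *m u \in E], forall g, rho g *m u \in E}.
  by move=> g /setIdP[].
rewrite -(sum_card_fibers XE) (eq_bigr (fun=> q)) => [|v vE].
  by rewrite sum_nat_const mulnC.
rewrite -(card_SL2_transporter rhoG (En0 uE) (En0 vE)); apply: eq_card => g.
by rewrite !inE; case: eqP => [->|]; rewrite ?andbF // vE !andbT.
Qed.

Lemma sum_return_count : \sum_(g in G) return_count g = (q * #|E| ^ 2)%N.
Proof.
rewrite /return_count (eq_bigr _ (fun g _ => card_sep_sum E _)) exchange_big /=.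
rewrite (eq_bigr (fun=> (q * #|E|)%N)) => [|u uE].
  by rewrite sum_nat_const mulnC -mulnA mulnn.
by rewrite -(card_to_E uE) card_sep_sum.
Qed.

(** The second moment counts triples g, u, v with u, v, g u, g v in E. For independent u, v the
    images determine g and have the same determinant; for proportional ones, g is among the q |E|
    elements taking u into E. *)
Lemma sum_return_count_sqr :
  (\sum_(g in G) return_count g ^ 2 <= \sum_t det_count E t ^ 2 + D * (q * #|E|))%N.
Proof.
have -> : (\sum_(g in G) return_count g ^ 2 =
  \sum_(z in setX E E) #|[set g in G | (rho g *m z.1 \in E) && (rho g *m z.2 \in E)]|)%N.
  rewrite [RHS](eq_bigr _ (fun z _ => card_sep_sum G _)) exchange_big /=.
  apply: eq_bigr => g gG; rewrite -card_sep_sum /return_count -mulnn -cardsX.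
  apply: eq_card => -[u v]; rewrite !inE /=.
  by case: (u \in E); case: (v \in E); rewrite ?andbF.
have -> : (\sum_t det_count E t ^ 2 = \sum_(z in setX E E) det_count E (cross z.1 z.2))%N.
  rewrite [RHS](partition_big (fun z => cross z.1 z.2) predT) //=; apply: eq_bigr => t _.
  rewrite (eq_bigr (fun=> det_count E t)) => [|z /andP[_ /eqP ->]] //.
  rewrite sum_nat_const -mulnn; congr (_ * _)%N; rewrite /det_count.
  by apply: eq_card => z; rewrite !inE [RHS]unfold_in /= !inE.
have -> : (D * (q * #|E|) = \sum_(z in setX E E) (if cross z.1 z.2 == 0%R then q * #|E| else 0))%N.
  rewrite -big_mkcondr sum_nat_const; congr (_ * _)%N.
  by apply: eq_card => z; rewrite !inE [RHS]unfold_in /= !inE.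
rewrite -big_split; apply: leq_sum => -[u v] /setXP[uE vE] /=.
case: eqVneq => uv.
  apply: leq_trans (leq_addl _ _); rewrite -(card_to_E uE).
  by apply: subset_leq_card; apply/subsetP => g /setIdP[gG /andP[h _]]; apply/setIdP.
rewrite addn0 -(@card_in_imset _ _ (fun g => (rho g *m u, rho g *m v))); last first.
  by move=> g h _ _ [e1 e2]; apply: (SL2_eq rhoG uv).
apply: subset_leq_card; apply/subsetP => _ /imsetP[g /setIdP[gG /andP[gu gv]] ->].
by apply/setIdP; rewrite in_setX gu gv /= cross_mul (det_SL2 rhoG gG) mul1r.
Qed.

(** The subtracted constant is the mean of [return_count] over G. The main terms then add up to
    -|E|^4 / (q (q^2 - 1)) <= 0, leaving the two error terms q |E| [D]. *)
Lemma return_variance (R : realFieldType) :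
  \sum_(g in G) ((return_count g)%:R - #|E|%:R ^+ 2 / (q%:R ^+ 2 - 1)) ^+ 2
    <= 2 * q%:R * #|E|%:R * D%:R :> R.
Proof.
have q2 : 2 <= q%:R :> R by rewrite (ler_nat R 2) card_finNzRing_gt1.
set n : R := #|E|%:R; set d : R := D%:R; set Q : R := q%:R in q2 *; set m := _ / _.
have q0 : Q != 0 by lra.
have q1 : Q ^+ 2 - 1 != 0 by rewrite subr_eq0; apply/eqP; nra.
have s1 : \sum_(g in G) (return_count g)%:R = Q * n ^+ 2 :> R.
  by rewrite -natr_sum sum_return_count natrM natrX.
have s0 : \sum_(g in G) (1 : R) = Q * (Q ^+ 2 - 1).
  rewrite sumr_const (card_SL2 rhoG) natrM natrB ?natrX //.
  by rewrite expn_gt0; apply/orP; left; apply/card_gt0P; exists 0.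
have s2 : \sum_(g in G) (return_count g)%:R ^+ 2 <= n ^+ 4 / Q + Q * n * d + d * (Q * n).
  have := sum_return_count_sqr; rewrite -(ler_nat R) natrD natrM natrM !natr_sum => h.
  have h2 := sum_det_count_sqr R E0.
  under eq_bigr do rewrite -natrX.
  apply: le_trans h _; rewrite lerD2r; apply: le_trans h2.
  by under eq_bigr do rewrite natrX.
have -> : \sum_(g in G) ((return_count g)%:R - m) ^+ 2 =
  \sum_(g in G) (return_count g)%:R ^+ 2 - 2 * m * (\sum_(g in G) (return_count g)%:R) +
  m ^+ 2 * \sum_(g in G) (1 : R).
  by rewrite !big_distrr -sumrB -big_split /=; apply: eq_bigr => g _; ring.
rewrite s1 s0.
have : n ^+ 4 / Q - 2 * m * (Q * n ^+ 2) + m ^+ 2 * (Q * (Q ^+ 2 - 1)) =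
   - (n ^+ 4 / (Q * (Q ^+ 2 - 1))).
  by rewrite /m; field; apply/andP; split.
have : 0 <= n ^+ 4 / (Q * (Q ^+ 2 - 1)).
  apply: divr_ge0; first by rewrite exprn_ge0 // ler0n.
  by apply: mulr_ge0; nra.
set a := n ^+ 4 / (Q * _); set b := n ^+ 4 / Q in s2 *; lra.
Qed.

Section Bound.
Variables (S : {set gT}) (T : {set 'cV[F]_2}) (k : nat).
Hypotheses (SG : S \subset G) (SV : (S^-1 = S)%g).
Hypothesis ST : forall g u, g \in S -> u \in E -> rho g *m u \in T.
Hypothesis Ek : forall u, u \in E -> (#|[set v in E | cross u v == 0%R]| <= k)%N.

Let D_le : (D <= #|E| * k)%N.
Proof.
apply: (card_fibers_le (f := fun z => z.1)) => [[u v] /setIdP[/setXP[]] //|u uE].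
apply: leq_trans (Ek uE).
rewrite -(@card_in_imset _ _ (fun z => z.2)) => [|[a b] [c d]]; last first.
  by case/setIdP=> _ /eqP /= -> /setIdP[_ /eqP /= ->] ->.
apply: subset_leq_card; apply/subsetP => _ /imsetP[[a b] /setIdP[/setIdP[/setXP[_ bE] c] /eqP e] ->].
by apply/setIdP; split=> //; rewrite -e.
Qed.

Let phi x := #|[set g in S | rho g *m x \in E]|.

Let inv_act g x y : g \in G -> rho g *m x = y -> x = rho g^-1%g *m y.
Proof. by move=> gG <-; rewrite mulmxA -(rhoM rhoG) mulVg (rho1 rhoG) mul1mx. Qed.

Let act_inj g : injective (mulmx (rho g) : 'cV[F]_2 -> 'cV[F]_2).
Proof.
by move=> x y e; rewrite -[x]mul1mx -[y]mul1mx -(rho1 rhoG) -(mulVg g) (rhoM rhoG) -!mulmxA e.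
Qed.

Let sum_phi : (\sum_x phi x = #|S| * #|E|)%N.
Proof.
rewrite /phi (eq_bigr _ (fun x _ => card_sep_sum S _)) exchange_big /=.
rewrite (eq_bigr (fun=> #|E|)) => [|g gS]; first by rewrite sum_nat_const.
rewrite -[RHS](on_card_preimset (f := mulmx (rho g))); last first.
  exists (mulmx (rho g^-1)%g) => x _; rewrite mulmxA -(rhoM rhoG) ?mulVg ?mulgV (rho1 rhoG) mul1mx //.
by rewrite -sum1_card [RHS]big_mkcond; apply: eq_bigr => x _; rewrite inE; case: ifP.
Qed.

(** If g x lies in E, then x = g^-1 (g x) with g^-1 in S by symmetry. *)
Let phi_supp x : phi x != 0%N -> x \in T.
Proof.
rewrite -lt0n => /card_gt0P[g /setIdP[gS gx]].
rewrite (inv_act (subsetP SG _ gS) (erefl (rho g *m x))); apply: ST => //.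
by rewrite -SV mem_invg invgK.
Qed.

(** For a pair g, h in S, substitute y = h x: both g x and h x lie in E exactly when y and g h^-1 y
    do. *)
Let sum_phi_sqr : (\sum_x phi x ^ 2 = \sum_(g in G) rep S g * return_count g)%N.
Proof.
have -> : (\sum_x phi x ^ 2 = \sum_(z in setX S S) return_count (z.1 * z.2^-1)%g)%N.
  rewrite (eq_bigr (fun x => \sum_(z in setX S S) ((rho z.1 *m x \in E) && (rho z.2 *m x \in E)))%N);
    last first.
    move=> x _; rewrite /phi -mulnn -cardsX -card_sep_sum; apply: eq_card => -[g h].
    by rewrite !inE /=; case: (g \in S); case: (h \in S); rewrite ?andbF.
  rewrite exchange_big; apply: eq_bigr => -[g h] /setXP[gS hS] /=.
  transitivity #|[set x | (rho g *m x \in E) && (rho h *m x \in E)]|.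
    by rewrite -sum1_card [RHS]big_mkcond; apply: eq_bigr => x _; rewrite inE; case: ifP.
  rewrite -(card_imset _ (@act_inj h)); apply: eq_card => y; apply/imsetP/setIdP.
    case=> x; rewrite inE => /andP[gx hx] ->; split=> //.
    by rewrite mulmxA -(rhoM rhoG) mulgKV.
  case=> yE gy; exists (rho h^-1%g *m y).
    by rewrite inE !mulmxA -!(rhoM rhoG) gy mulgV (rho1 rhoG) mul1mx.
  by rewrite mulmxA -(rhoM rhoG) mulgV (rho1 rhoG) mul1mx.
rewrite (partition_big (fun z => (z.1 * z.2^-1)%g) (mem G)) /=; last first.
  by move=> [g h] /setXP[/(subsetP SG) gG /(subsetP SG) hG]; rewrite /= groupM ?groupV.
apply: eq_bigr => g gG; rewrite (eq_bigr (fun=> return_count g)) => [|z /andP[_ /eqP ->]] //.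
rewrite sum_nat_const; congr (_ * _)%N; rewrite /rep.
by apply: eq_card => z; rewrite !inE [LHS]unfold_in /= !inE.
Qed.

(** X is the correlation of [rep S] with the centred return count. The first inequality is
    Cauchy-Schwarz for [phi] on T, the second Cauchy-Schwarz between energy and variance. *)
Let main_ineq (R : realFieldType) :
  let m := #|E|%:R ^+ 2 / (q%:R ^+ 2 - 1) : R in
  exists2 X : R, (#|S|%:R * #|E|%:R) ^+ 2 <= #|T|%:R * (X + m * #|S|%:R ^+ 2)
    & X ^+ 2 <= (energy S)%:R * (2 * q%:R * #|E|%:R * D%:R).
Proof.
move=> m; exists (\sum_(g in G) (rep S g)%:R * ((return_count g)%:R - m)); last first.
  apply: le_trans (sum_mul_sqr_le _ _ _) _; apply: ler_pM; rewrite ?return_variance //.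
  - by apply: sumr_ge0 => g _; apply: sqr_ge0.
  - by apply: sumr_ge0 => g _; apply: sqr_ge0.
  rewrite /energy natr_sum [leRHS](bigID (mem G)) /=.
  under [X in _ <= X + _]eq_bigr do rewrite natrX.
  by rewrite lerDl; apply: sumr_ge0 => g _; apply: ler0n.
have rep_out g : g \notin G -> rep S g = 0%N.
  move=> gG; apply/eqP; rewrite cards_eq0 -subset0; apply/subsetP=> -[a b].
  case/setIdP=> /setXP[/(subsetP SG) aG /(subsetP SG) bG] /= /eqP e.
  by case/negP: gG; rewrite -e groupM ?groupV.
have sr : \sum_(g in G) (rep S g)%:R = #|S|%:R ^+ 2 :> R.
  rewrite -natr_sum -natrX -(sum_rep S) [in RHS](bigID (mem G)) /=; congr _%:R.
  by rewrite [X in (_ + X)%N]big1 ?addn0 // => g /rep_out.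
have -> : \sum_(g in G) (rep S g)%:R * ((return_count g)%:R - m) + m * #|S|%:R ^+ 2 =
    (\sum_x phi x ^ 2)%:R.
  rewrite sum_phi_sqr natr_sum -sr big_distrr -big_split /=; apply: eq_bigr => g _.
  by rewrite natrM; ring.
rewrite -natrM -natrX -sum_phi -natrM ler_nat.
have split_T (f : 'cV[F]_2 -> nat) : (forall x, x \notin T -> f x = 0%N) ->
    (\sum_x f x = \sum_(x in T) f x)%N.
  by move=> fT; rewrite (bigID (mem T)) /= [X in (_ + X)%N]big1 ?addn0.
have phi0 x : x \notin T -> phi x = 0%N.
  by move=> xT; apply/eqP; apply: contraNT xT; apply: phi_supp.
rewrite (split_T phi) // (split_T (fun x => phi x ^ 2)%N) => [|x /phi0 ->] //.
exact: sqr_sum_le.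
Qed.

(** If 2 |T| < q^2 - 1, the mean term is at most half of (|S| |E|)^2, so X carries the other half.
    Squaring, inserting [D] <= |E| k and cancelling |E|^2 gives the second alternative. *)
Lemma image_bound :
  (#|F| ^ 2 - 1 <= 2 * #|T| \/
   #|S| ^ 4 * #|E| ^ 2 <= 8 * #|T| ^ 2 * (#|F| * k * energy S))%N.
Proof.
have [le|lt] := leqP (#|F| ^ 2 - 1) (2 * #|T|); [by left | right].
have [X h1 h2] := main_ineq rat.
have q2 : 2 <= q%:R :> rat by rewrite (ler_nat rat 2) card_finNzRing_gt1.
have q1 : 0 < q%:R ^+ 2 - 1 :> rat by nra.
have lt' : 2 * #|T|%:R <= q%:R ^+ 2 - 1 :> rat.
  have := ltnW lt; rewrite -(ler_nat rat) natrM natrB ?natrX //.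
  by rewrite expn_gt0; apply/orP; left; apply/card_gt0P; exists 0.
set s : rat := #|S|%:R in h1 *; set n : rat := #|E|%:R in h1 h2 *.
have [n0|n0] := eqVneq #|E| 0%N; first by rewrite n0 muln0.
have np : 0 < n by rewrite ltr0n lt0n.
set t : rat := #|T|%:R in lt' h1 *.
have t0 : 0 <= t by apply: ler0n.
have h3 : (s * n) ^+ 2 <= 2 * (t * X).
  have : t * (n ^+ 2 / (q%:R ^+ 2 - 1) * s ^+ 2) <= (s * n) ^+ 2 / 2.
    rewrite ler_pdivlMr //.
    have -> : t * (n ^+ 2 / (q%:R ^+ 2 - 1) * s ^+ 2) * 2 =
      (s * n) ^+ 2 * (2 * t) / (q%:R ^+ 2 - 1) by ring.
    by rewrite ler_pdivrMr // ler_wpM2l // sqr_ge0.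
  by move: h1; rewrite mulrDr; set a := t * X; set b := t * _; lra.
have h4 : (s * n) ^+ 4 <= 4 * t ^+ 2 * X ^+ 2.
  have -> : 4 * t ^+ 2 * X ^+ 2 = (2 * (t * X)) ^+ 2 by ring.
  rewrite (exprM _ 2 2); apply: lerXn2r => //; rewrite ?nnegrE ?sqr_ge0 //.
  by apply: le_trans h3; apply: sqr_ge0.
have Dk : D%:R <= n * k%:R by rewrite -natrM ler_nat.
have h5 : (s * n) ^+ 4 <= 4 * t ^+ 2 * ((energy S)%:R * (2 * q%:R * n * (n * k%:R))).
  apply: le_trans h4 _; apply: ler_wpM2l; first by rewrite mulr_ge0 // sqr_ge0.
  apply: le_trans h2 _; apply: ler_wpM2l; first exact: ler0n.
  by apply: ler_wpM2l => //; rewrite !mulr_ge0 ?ler0n.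
rewrite -(ler_nat rat) -(ler_pM2r (exprn_gt0 2 np)).
have -> : (#|S| ^ 4 * #|E| ^ 2)%N%:R = s ^+ 4 * n ^+ 2 by rewrite natrM natrX natrX.
have -> : (8 * #|T| ^ 2 * (#|F| * k * energy S))%N%:R =
    8 * t ^+ 2 * (q%:R * k%:R * (energy S)%:R) :> rat.
  rewrite natrM [(8 * _)%N%:R]natrM natrX [(_ * energy S)%N%:R]natrM.
  by rewrite [(_ * k)%N%:R]natrM.
have -> : s ^+ 4 * n ^+ 2 * n ^+ 2 = (s * n) ^+ 4 by ring.
by apply: le_trans h5 _; rewrite le_eqVlt; apply/orP; left; apply/eqP; ring.
Qed.

End Bound.
End Image.

(** * The theorem *)

Lemma GLval_sl2_model (p : nat) : sl2_model (SL2_group p) (@GLval 2 'F_p).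
Proof.
split.
- exact: val_inj.
- by [].
- by [].
- by move=> g; rewrite inE => /eqP.
move=> A dA; have uA : A \is a GRing.unit.
  by rewrite -[_ \is a _]/(\det A \is a GRing.unit) dA unitr1.
by exists (FinRing.unit _ uA) => //; rewrite inE /= dA.
Qed.

Lemma Fp_char_neq2 (p : nat) : prime p -> (2 < p)%N -> 2 != 0 :> 'F_p.
Proof.
move=> p_pr p2; apply/eqP => e.
have := pchar_Fp p_pr; move/dvdn_pcharf/(_ 2%N); rewrite e eqxx => /dvdn_leq.
by move=> /(_ isT); rewrite leqNgt p2.
Qed.

Section Lines.
Variables (p : nat) (E : {set 'cV['F_p]_2}).
Hypotheses (p_pr : prime p) (E0 : 0 \notin E).

Let En0 u : u \in E -> u != 0.
Proof. by apply: contraTneq => ->. Qed.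

Lemma card_line_le_p u : u \in E -> (#|[set v in E | cross u v == 0%R]| <= p)%N.
Proof.
move=> uE; rewrite -[X in (_ <= X)%N](card_Fp p_pr) -cardsT.
apply: leq_trans (_ : #|[set a *: u | a in [set: 'F_p]]| <= _)%N; last exact: leq_imset_card.
apply: subset_leq_card; apply/subsetP => v /setIdP[_ /(cross_eq0P _ (En0 uE))[a ->]].
by apply/imsetP; exists a; rewrite ?inE.
Qed.

Lemma card_line_le k : at_most_on_lines k E ->
  forall u, u \in E -> (#|[set v in E | cross u v == 0%R]| <= k)%N.
Proof.
move=> h u uE; have := h <[u]>%VS; rewrite dim_vline (En0 uE) => /(_ erefl).
apply: leq_trans; apply: subset_leq_card; apply/subsetP => v /setIdP[vE c].
apply/setIdP; split=> //; apply/vlineP.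
by case/(cross_eq0P _ (En0 uE)): c => a ->; exists a.
Qed.

End Lines.

(** * Real powers and an integer scale *)

Section Analytic.
Variable R : realType.

Lemma sqr_powR_half (x : R) : 0 <= x -> (x `^ (1 / 2)) ^+ 2 = x.
Proof.
by move=> x0; rewrite -powR_mulrn ?powR_ge0 // -powRrM divfK ?pnatr_eq0 // powRr1.
Qed.

Lemma powR_expn (x a : R) n : (x `^ a) ^+ n = x `^ (a * n%:R).
Proof. by rewrite powRrM powR_mulrn ?powR_ge0. Qed.

(** K is the integer part of p^eps. Once p > 2^(1/eps), K is at least 2 and p^eps < K + 1 <= 2K. *)
Lemma exists_scale (eps : R) : 0 < eps -> exists p0 : nat, forall p : nat, (p0 <= p)%N ->
  exists K : nat, [/\ (1 < K)%N, K%:R <= p%:R `^ eps & p%:R `^ eps <= 2 * K%:R].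
Proof.
move=> e0; exists (Num.truncn (2 `^ (eps^-1) : R)).+1 => p hp.
have hp' : 2 `^ (eps^-1) < p%:R :> R.
  apply: lt_le_trans (_ : (Num.truncn (2 `^ (eps^-1) : R)).+1%:R <= _); last by rewrite ler_nat.
  exact: truncnS_gt.
have h2 : 2 <= p%:R `^ eps :> R.
  have -> : 2 = (2 `^ (eps^-1)) `^ eps :> R by rewrite -powRrM mulVf ?lt0r_neq0 // powRr1.
  by apply: ge0_ler_powR; rewrite ?nnegrE ?powR_ge0 ?ler0n // ltW.
set x := _ `^ _ in h2 *; have /andP[k1 k2] := truncn_itv (le_trans (ler0n _ 2) h2).
exists (Num.truncn x); split=> //; first by rewrite truncn_gt_nat.
have : 1 <= (Num.truncn x)%:R :> R by rewrite ler1n truncn_gt_nat (le_trans _ h2) ?ler1n.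
by move: k2; rewrite -natr1; lra.
Qed.

End Analytic.

Section Assembly.
Variable R : realType.

(** Here K^(32 x 125) <= p^(gamma/2), which the coset hypothesis compensates exactly; the size
    conditions follow from gamma/2 <= gamma and gamma/2 + 3 - 2 gamma <= 3. *)
Lemma energy_bound (gamma : R) (p K : nat) (S : {set {'GL_2['F_p]}}) :
  0 < gamma -> prime p -> (2 < p)%N -> (1 < K)%N ->
  K%:R <= p%:R `^ (gamma / 2 / (32 * 125)%N%:R) ->
  S \subset SL2 p -> p%:R `^ gamma < #|S|%:R -> #|S|%:R < p%:R `^ (3 - 2 * gamma) ->
  non_concentrated gamma S -> (K * energy S < #|S| ^ 3)%N.
Proof.
move=> g0 p_pr p2 K1 hK SG Sl Su nc.
have N0 : (32 * 125)%N%:R != 0 :> R by rewrite pnatr_eq0.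
have pR : 1 <= p%:R :> R by rewrite ler1n prime_gt0.
have pn0 : p%:R != 0 :> R by rewrite pnatr_eq0 -lt0n prime_gt0.
have hKN : (K ^ (32 * 125))%N%:R <= p%:R `^ (gamma / 2) :> R.
  rewrite natrX -[X in _ <= _ `^ X](divfK N0) -powR_expn.
  by apply: lerXn2r; rewrite ?nnegrE ?powR_ge0 ?ler0n.
have S0 : 0 <= #|S|%:R :> R by apply: ler0n.
have pg0 a : 0 < p%:R `^ a :> R by apply: powR_gt0; apply: lt_le_trans pR.
apply: (@energy_flattening 'F_p _ (SL2_group p) (@GLval 2 'F_p)) => //.
- exact: GLval_sl2_model.
- exact: Fp_char_neq2.
- move=> H g HG gG; rewrite -(ler_nat R) natrM.
  apply: le_trans (_ : p%:R `^ (gamma / 2) * (p%:R `^ (- (gamma / 2)) * #|S|%:R) <= _).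
    by apply: ler_pM; rewrite ?ler0n // ltW // nc.
  rewrite mulrA -powRD; first by rewrite subrr powRr0 mul1r.
  by rewrite pn0 implybT.
- rewrite -(ler_nat R); apply: le_trans hKN _; apply: le_trans (ltW Sl).
  by apply: ler_powR => //; lra.
rewrite -(ler_nat R) natrM [(_ ^ 3)%N%:R]natrX card_Fp //.
apply: le_trans (_ : p%:R `^ (gamma / 2) * p%:R `^ (3 - 2 * gamma) <= _).
  by apply: ler_pM => //; rewrite ?ler0n // ltW.
rewrite -powRD; last by rewrite pn0 implybT.
by rewrite -powR_mulrn //; apply: ler_powR => //; lra.
Qed.

(** The first alternative gives t >= (p^2 - 1)/2 >= p^2/4. In the second, K e < s^3 and p^eps <= 2K
    yield s n^2 <= 16 t^2 k p^(1 - eps), whose square root accounts for the constant 1/4. *)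
Lemma min_bound (p K k s n t e : nat) (eps : R) : (1 < p)%N -> (0 < k)%N -> (0 < s)%N ->
  p%:R `^ eps <= 2 * K%:R :> R -> (K * e < s ^ 3)%N ->
  (p ^ 2 - 1 <= 2 * t \/ s ^ 4 * n ^ 2 <= 8 * t ^ 2 * (p * k * e))%N ->
  1 / 4 * Num.min (p%:R ^+ 2)
     (s%:R `^ (1 / 2) * n%:R / (p%:R `^ ((1 - eps) / 2) * k%:R `^ (1 / 2))) <= t%:R :> R.
Proof.
move=> p1 k0 s0 hK he [h|h].
  have p2 : 2 <= p%:R :> R by rewrite (ler_nat R 2).
  have t2 : p%:R ^+ 2 - 1 <= 2 * t%:R :> R.
    by move: h; rewrite -(ler_nat R) natrM natrB ?natrX // expn_gt0 ltnW.
  have := ge_min (p%:R ^+ 2 : R) (p%:R ^+ 2) (s%:R `^ (1 / 2) * n%:R / (p%:R `^ ((1 - eps) / 2) * k%:R `^ (1 / 2))).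
  by rewrite lexx /= => hm; nra.
have p0 : 0 < p%:R :> R by rewrite ltr0n ltnW.
set D := _ * k%:R `^ _; have D0 : 0 < D by rewrite mulr_gt0 // powR_gt0 // ltr0n.
have hD : D ^+ 2 = p%:R `^ (1 - eps) * k%:R.
  by rewrite exprMn sqr_powR_half ?ler0n // powR_expn divfK ?pnatr_eq0.
clearbody D.
have key : s%:R `^ (1 / 2) * n%:R / D <= 4 * t%:R :> R.
  rewrite ler_pdivrMr // -ler_sqr ?nnegrE ?mulr_ge0 ?powR_ge0 ?ler0n // ?(ltW D0) //.
  rewrite !exprMn hD sqr_powR_half ?ler0n //.
  have s3 : 0 < s%:R ^+ 3 :> R by rewrite exprn_gt0 // ltr0n.
  have pe : 0 < p%:R `^ eps :> R by rewrite powR_gt0.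
  rewrite -(ler_pM2r s3) -(ler_pM2r pe).
  have h1 : s%:R ^+ 4 * n%:R ^+ 2 <= 8 * t%:R ^+ 2 * (p%:R * k%:R * e%:R) :> R.
    by move: h; rewrite -(ler_nat R) => h; apply: le_trans (le_trans _ h) _; rewrite !natrM ?natrX.
  have h2 : K%:R * e%:R <= s%:R ^+ 3 :> R by rewrite -natrM -natrX ler_nat ltnW.
  have pp : p%:R `^ (1 - eps) * p%:R `^ eps = p%:R :> R.
    by rewrite -powRD ?subrK ?powRr1 ?ler0n // lt0r_neq0 ?implybT.
  have -> : s%:R * n%:R ^+ 2 * s%:R ^+ 3 * p%:R `^ eps = p%:R `^ eps * (s%:R ^+ 4 * n%:R ^+ 2) :> R by ring.
  have -> : 4 ^+ 2 * t%:R ^+ 2 * (p%:R `^ (1 - eps) * k%:R) * s%:R ^+ 3 * p%:R `^ eps =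
    16 * t%:R ^+ 2 * k%:R * (p%:R `^ (1 - eps) * p%:R `^ eps) * s%:R ^+ 3 :> R by ring.
  rewrite pp.
  apply: le_trans (_ : 2 * K%:R * (8 * t%:R ^+ 2 * (p%:R * k%:R * e%:R)) <= _).
    by apply: ler_pM => //; rewrite ?powR_ge0 // mulr_ge0 ?exprn_ge0 ?ler0n.
  have -> : 2 * K%:R * (8 * t%:R ^+ 2 * (p%:R * k%:R * e%:R)) =
     16 * t%:R ^+ 2 * k%:R * p%:R * (K%:R * e%:R) :> R by ring.
  by apply: ler_wpM2l => //; rewrite !mulr_ge0 ?exprn_ge0 ?ler0n.
have hm : Num.min (p%:R ^+ 2) (s%:R `^ (1 / 2) * n%:R / D) <= s%:R `^ (1 / 2) * n%:R / D.
  by rewrite ge_min lexx orbT.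
by have := le_trans hm key; lra.
Qed.

End Assembly.

Unset Implicit Arguments.

Theorem theorem3p2 (R : realType) (gamma : R) (gamma_gt0 : 0 < gamma)
    (gamma_lt1 : gamma < 1) :
  exists eps : R, 0 < eps /\
  exists c : R, 0 < c /\
  exists p0 : nat, forall p : nat, prime p -> (p0 <= p)%N ->
  forall (E : {set 'cV['F_p]_2}) (S : {set {'GL_2['F_p]}}),
    0 \notin E ->
    S \subset SL2 p ->
    S = (S^-1)%g ->
    p%:R `^ gamma < #|S|%:R ->
    #|S|%:R < p%:R `^ (3 - 2 * gamma) ->
    non_concentrated gamma S ->
    #|SL2_image S E|%:R >=
      c * Num.min (p%:R ^+ 2)
                  (#|S|%:R `^ (1 / 2) * #|E|%:R / p%:R `^ (1 - eps / 2))
    /\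
    forall k : nat, at_most_on_lines k E ->
      #|SL2_image S E|%:R >=
        c * Num.min (p%:R ^+ 2)
                    (#|S|%:R `^ (1 / 2) * #|E|%:R
                     / (p%:R `^ ((1 - eps) / 2) * k%:R `^ (1 / 2))).
Proof.
(* With this eps, K <= p^eps yields K^(32 x 125) <= p^(gamma/2), as [energy_bound] requires. *)
pose eps := gamma / 2 / (32 * 125)%N%:R; exists eps.
have eps0 : 0 < eps by rewrite !divr_gt0 // ltr0n.
split=> //; exists (1 / 4); split; first by rewrite divr_gt0.
have [p0 hp0] := exists_scale eps0; exists (maxn p0 3) => p p_pr.
rewrite geq_max => /andP[/hp0[K [K1 hK hK']] p3] E S E0 SG SV Sl Su nc.
have hE := energy_bound gamma_gt0 p_pr p3 K1 hK SG Sl Su nc.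
have S0 : (0 < #|S|)%N by rewrite -(ltr0n R); apply: le_lt_trans Sl; apply: powR_ge0.
have ST g u : g \in S -> u \in E -> GLval g *m u \in SL2_image S E.
  by move=> gS uE; apply/imset2P; exists g u.
have bound k : (0 < k)%N -> (forall u, u \in E -> (#|[set v in E | cross u v == 0%R]| <= k)%N) ->
    1 / 4 * Num.min (p%:R ^+ 2) (#|S|%:R `^ (1 / 2) * #|E|%:R
      / (p%:R `^ ((1 - eps) / 2) * k%:R `^ (1 / 2))) <= #|SL2_image S E|%:R.
  move=> k0 hk; apply: (min_bound _ _ _ hK' hE) => //; first exact: prime_gt1.
  have := image_bound (GLval_sl2_model p) E0 SG (esym SV) ST hk.
  by rewrite card_Fp.
split=> [|k hk].
  have pR : 0 < p%:R :> R by rewrite ltr0n prime_gt0.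
  (* The first bound is the second with k = p: a line has at most p points of E, and p^((1 - eps)/2)
     p^(1/2) = p^(1 - eps/2). *)
  have -> : 1 - eps / 2 = (1 - eps) / 2 + 1 / 2 by field.
  rewrite powRD; last by rewrite (lt0r_neq0 pR) implybT.
  by apply: bound (prime_gt0 p_pr) _ => u; apply: card_line_le_p.
have hk' := card_line_le E0 hk.
(* For k = 0 the set E is empty, because each of its points lies on the line it spans; the minimum
   is then at most 0. *)
have [k0|k0] := posnP k; last exact: bound.
have -> : E = finset.set0.
  apply/setP=> u; rewrite inE; apply/negP => uE; have := hk' u uE.
  rewrite k0 leqn0 cards_eq0 => /eqP/setP/(_ u).
  by rewrite !inE uE crossvv eqxx.
rewrite cards0 mulr0 mul0r; apply: le_trans (ler0n _ _).
have c0 : 0 < 1 / 4 :> R by rewrite divr_gt0.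
by rewrite (pmulr_rle0 _ c0) ge_min lexx orbT.
Qed.
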